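(* Assume $\inf_{x\in\mathbb R}V''(x)>0$. Then for every integer $n\ge1$, $$n\,\inf_{x\in\mathbb R}V''(x)\ \le\ \lambda_n(-L)\ \le\ n\,\sup_{x\in\mathbb R}V''(x),$$ with the right-hand side equal to $+\infty$ if $V''$ is unbounded from above.
   Context: $V\in C^\infty(\mathbb R)$, $\mu$ the probability measure with density proportional to $e^{-V}$, and $Lf=f''-V'f'$, regarded as a self-adjoint operator in $L^2(\mu)$ (unique self-adjoint extension from $C_0^\infty(\mathbb R)$). For $n\ge1$, $\lambda_n(-L)=\sup_{g_0,\dots,g_{n-1}\in L^2(\mu)}\inf_{f\in D(-L)\setminus\{0\},\,f\perp_\mu g_i}\frac{\int f(-Lf)\,d\mu}{\int f^2d\mu}$ (max-min values). *)

(* Defs.v *)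
From HB Require Import structures.
From mathcomp Require Import all_boot all_order all_algebra.
From mathcomp Require Import all_classical all_reals all_analysis.
Set Implicit Arguments. Unset Strict Implicit. Unset Printing Implicit Defensive.
Import Order.TTheory GRing.Theory Num.Theory.
Import numFieldNormedType.Exports.
Local Open Scope classical_set_scope.
Local Open Scope ring_scope.

Section Defs.
Variable R : realType.

Definition smooth (f : R -> R) : Prop :=
  forall (n : nat) (x : R), derivable (derive1n n f) x 1.

Definition test_fun (f : R -> R) : Prop :=
  smooth f /\ exists M : R, forall x, M < `|x| -> f x = 0.

Definition Zc (V : R -> R) : R :=
  fine (\int[@lebesgue_measure R]_x (expR (- V x))%:E).
Definition dens (V : R -> R) (x : R) : R := expR (- V x) / Zc V.

Definition muint (V : R -> R) (h : R -> R) : \bar R :=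
  \int[@lebesgue_measure R]_x (h x * dens V x)%:E.

Definition L2 (V : R -> R) (f : R -> R) : Prop :=
  measurable_fun [set: R] f /\ (muint V (fun x => (f x ^+ 2)%R) < +oo)%E.

Definition ip (V f g : R -> R) : R := fine (muint V (fun x => f x * g x)).

Definition Lop (V f : R -> R) (x : R) : R :=
  derive1n 2 f x - derive1 V x * derive1 f x.

(* graph of the self-adjoint extension of L (= closure of L on C_0^infinity):
   (f, g) with g = L f *)
Definition graphL (V f g : R -> R) : Prop :=
  L2 V f /\ L2 V g /\
  exists phi : nat -> R -> R,
    (forall k, test_fun (phi k)) /\
    (fun k => muint V (fun x => (phi k x - f x) ^+ 2)) @ \oo --> 0%E /\
    (fun k => muint V (fun x => (Lop V (phi k) x - g x) ^+ 2)) @ \oo --> 0%E.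

Definition lambda (V : R -> R) (n : nat) : \bar R :=
  ereal_sup [set m : \bar R | exists gs : 'I_n -> R -> R,
    (forall i, L2 V (gs i)) /\
    m = ereal_inf [set q : \bar R | exists f Lf : R -> R,
          graphL V f Lf /\ ip V f f <> 0 /\
          (forall i, ip V f (gs i) = 0) /\
          q = ((- ip V f Lf) / ip V f f)%:E]].

End Defs.

(* Main.v *)
Require Import Defs.
From HB Require Import structures.
From mathcomp Require Import all_boot all_order all_algebra.
From mathcomp Require Import all_classical all_reals all_analysis.
From mathcomp Require Import measurable_realfun ring lra.
Set Implicit Arguments. Unset Strict Implicit. Unset Printing Implicit Defensive.
Import Order.TTheory GRing.Theory Num.Theory.
Import numFieldNormedType.Exports.
Local Open Scope classical_set_scope.
Local Open Scope ring_scope.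

(** Write [A] for the derivative and [A* v = V' v - v'] for its adjoint in L2(mu), so that
    [-L = A* A] while [A A* = -L + V'']; both bounds follow by induction on [n] from this
    commutation, and in both cases the extremal objects are polynomials.

    Upper bound, with [K = sup V'']: for a polynomial [p] of degree at most [n],
    [|p'|^2 = <p, A* p'> <= |p| |A* p'|] and [|A* p'|^2 <= |p''|^2 + K |p'|^2 <= n K |p'|^2], hence
    [|p'|^2 <= n K |p|^2]; some nonzero such [p] is orthogonal to [g_0, ..., g_(n-1)].

    Lower bound, with [r = inf V'']: test against [g_i = x^i].  If [f] is orthogonal to
    [1, x, ..., x^n] then [f = A* v] with [v] orthogonal to [1, ..., x^(n-1)], because
    [<v, x^i> = <f, x^(i+1)> / (i+1)].  By induction
    [|f|^2 >= |v'|^2 + r |v|^2 >= (n+1) r |v|^2], and [|f|^2 = <v, f'> <= |v| |f'|] gives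
    [(n+1) r |f|^2 <= |f'|^2].  To pass to the closure of [L] the orthogonality is relaxed: the
    inequality is proved with an error term controlled by the moments [<f, x^i>]. *)

(** * Positivity of integrals of continuous functions *)

Lemma integral_continuous_gt0 (R : realType) (g : R -> R) x0 :
  continuous g -> (forall x, 0 <= g x) -> 0 < g x0 ->
  (0 < \int[@lebesgue_measure R]_x (g x)%:E)%E.
Proof.
set lm := @lebesgue_measure R.
move=> cg gpos g0.
have : \forall y \near x0, g x0 / 2 < g y.
  apply: (cvgr_gt _ (cg x0)); lra.
move=> [e /= e0 He].
pose I := `[x0 - e / 2, x0 + e / 2]%classic : set R.
have HI x : I x -> g x0 / 2 <= g x.
  rewrite /I /= in_itv /= => /andP[x1 x2]; apply/ltW/He => /=.
  rewrite ltr_norml; apply/andP; split; lra.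
(* On the interval [I] of length [e] the function stays above [g x0 / 2], so the integral is at
   least [g x0 / 2 * e]. *)
have : (\int[lm]_(x in I) (g x0 / 2)%:E <= \int[lm]_x (g x)%:E)%E.
  apply: (@le_trans _ _ (\int[lm]_(x in I) (g x)%:E)%E).
    have mI : measurable I by exact: measurable_itv.
    apply: ge0_le_integral => //.
    - by move=> x _; rewrite lee_fin ltW // divr_gt0.
    - by apply/measurable_EFinP/measurable_funTS; exact: continuous_measurable_fun.
  apply: ge0_subset_integral => //.
  - exact: measurable_itv.
  - by apply/measurable_EFinP; exact: continuous_measurable_fun.
  - by move=> x _; rewrite lee_fin.
rewrite integral_cst; last exact: measurable_itv.
rewrite [X in (_ * X <= _)%E](_ : _ = e%:E); last first.
  have E : @lebesgue_measure R I = (if (x0 - e / 2)%:E < (x0 + e / 2)%:E then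
    (x0 + e / 2)%:E - (x0 - e / 2)%:E else 0)%E by rewrite /I lebesgue_measure_itv.
  have H : x0 - e / 2 < x0 + e / 2 by lra.
  rewrite [LHS]E lte_fin H -EFinB; congr (_%:E); lra.
rewrite -EFinM; apply: lt_le_trans.
by rewrite lte_fin; apply: mulr_gt0; lra.
Qed.

(** * Integration against [mu] and the inner product of L2(mu) *)

Section WeightedIntegral.
Variables (R : realType) (V : R -> R).
Hypothesis cV : continuous V.
Notation lm := (@lebesgue_measure R).

(** Real-valued version of [muint]. Since [fine] sends an infinite integral to 0, the algebraic
    rules below carry [mu_integrable] hypotheses. *)
Definition mean (h : R -> R) : R := fine (muint V h).
Definition mu_integrable (h : R -> R) : Prop :=
  lm.-integrable [set: R] (EFin \o (fun x => h x * dens V x)).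

Lemma Zc_ge0 : 0 <= Zc V.
Proof. by apply/fine_ge0/integral_ge0 => x _; rewrite lee_fin expR_ge0. Qed.

Lemma dens_ge0 x : 0 <= dens V x.
Proof. by rewrite /dens divr_ge0 ?expR_ge0 ?Zc_ge0. Qed.

Lemma dens_continuous : continuous (dens V).
Proof.
move=> x; apply: cvgM; last exact: cvg_cst.
apply: (@continuous_comp _ _ _ (fun x => - V x) expR).
  by apply: cvgN; exact: cV.
exact: continuous_expR.
Qed.

Lemma dens_measurable : measurable_fun [set: R] (dens V).
Proof. exact: continuous_measurable_fun dens_continuous. Qed.

Lemma mu_integrableD f g : mu_integrable f -> mu_integrable g -> mu_integrable (fun x => f x + g x).
Proof.
move=> If Ig; rewrite /mu_integrable.
rewrite (_ : _ \o _ = (EFin \o (fun x => (f x * dens V x)%R)) \+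
  (EFin \o (fun x => (g x * dens V x)%R)))%E; first exact: integrableD.
by apply/funext => x /=; rewrite mulrDl EFinD.
Qed.

Lemma mu_integrableZ a f : mu_integrable f -> mu_integrable (fun x => a * f x).
Proof.
move=> If; rewrite /mu_integrable.
rewrite (_ : _ \o _ = (fun x => a%:E * (EFin \o (fun x => (f x * dens V x)%R)) x))%E.
  exact: integrableZl.
by apply/funext => x; rewrite /comp /= -mulrA EFinM.
Qed.

Lemma meanD f g : mu_integrable f -> mu_integrable g -> mean (fun x => f x + g x) = mean f + mean g.
Proof.
move=> If Ig; rewrite /mean /muint -!/(Rintegral _ _ _).
by under eq_Rintegral do rewrite mulrDl; rewrite RintegralD.
Qed.

Lemma meanZ a f : mu_integrable f -> mean (fun x => a * f x) = a * mean f.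
Proof.
move=> If; rewrite /mean /muint -!/(Rintegral _ _ _).
by under eq_Rintegral do rewrite -mulrA; rewrite RintegralZl.
Qed.

Lemma mean_ge0 f : (forall x, 0 <= f x) -> 0 <= mean f.
Proof.
by move=> f0; apply/fine_ge0/integral_ge0 => x _; rewrite lee_fin mulr_ge0 ?dens_ge0.
Qed.

Lemma le_mean f g : mu_integrable f -> mu_integrable g -> (forall x, f x <= g x) ->
  mean f <= mean g.
Proof.
move=> If Ig fg; rewrite /mean /muint -!/(Rintegral _ _ _).
by apply: le_Rintegral => // x _; rewrite ler_wpM2r ?dens_ge0.
Qed.

Lemma muintE f : mu_integrable f -> muint V f = (mean f)%:E.
Proof. by move=> If; rewrite /mean fineK //; apply: integrable_fin_num. Qed.

Lemma mu_integrable_le (f g : R -> R) : measurable_fun [set: R] f -> mu_integrable g ->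
  (forall x, `|f x| <= g x) -> mu_integrable f.
Proof.
move=> mf Ig fg; apply: (le_integrable _ _ _ Ig) => //.
  by apply/measurable_EFinP/measurable_funM => //; exact: dens_measurable.
have H (x : R) : `|f x * dens V x| <= `|g x * dens V x|.
  rewrite (normrM (f x)) (normrM (g x)) (ger0_norm (dens_ge0 x)) ler_wpM2r ?dens_ge0 //.
  by rewrite (le_trans (fg x)) // ler_norm.
by move=> x _; have := H x; rewrite -lee_fin.
Qed.

Lemma L2_integrable_sqr f : L2 V f -> mu_integrable (fun x => f x ^+ 2).
Proof.
move=> [mf fi]; apply/integrableP; split.
  apply/measurable_EFinP/measurable_funM; last exact: dens_measurable.
  exact: measurable_funX.
apply: le_lt_trans fi; rewrite le_eqVlt; apply/orP; left; apply/eqP.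
apply: eq_integral => x _ /=.
by rewrite ger0_norm // mulr_ge0 ?sqr_ge0 ?dens_ge0.
Qed.

Lemma integrable_sqr_L2 (f : R -> R) : measurable_fun [set: R] f ->
  mu_integrable (fun x => f x ^+ 2) -> L2 V f.
Proof. by move=> mf If; split => //; rewrite muintE // ltry. Qed.

Lemma L2_integrableM f g : L2 V f -> L2 V g -> mu_integrable (fun x => f x * g x).
Proof.
move=> Lf Lg; apply: (@mu_integrable_le _ (fun x => f x ^+ 2 + g x ^+ 2)).
- by apply: measurable_funM; [case: Lf|case: Lg].
- by apply: mu_integrableD; exact: L2_integrable_sqr.
move=> x; rewrite normrM -(real_normK (num_real (f x))) -(real_normK (num_real (g x))).
by have := normr_ge0 (f x); have := normr_ge0 (g x); nra.
Qed.

Lemma L2D f g : L2 V f -> L2 V g -> L2 V (fun x => f x + g x).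
Proof.
move=> Lf Lg; apply: integrable_sqr_L2.
  by apply: measurable_funD; [case: Lf|case: Lg].
rewrite (_ : (fun x => _) =
  (fun x => f x ^+ 2 + g x ^+ 2 + 2 * (f x * g x))); last by apply/funext => x; ring.
apply: mu_integrableD; first by apply: mu_integrableD; exact: L2_integrable_sqr.
by apply: mu_integrableZ; exact: L2_integrableM.
Qed.

Lemma L2Z a f : L2 V f -> L2 V (fun x => a * f x).
Proof.
move=> Lf; apply: integrable_sqr_L2.
  by apply: measurable_funM => //; case: Lf.
rewrite (_ : (fun x => _) = (fun x => a ^+ 2 * f x ^+ 2)); last by apply/funext => x; ring.
by apply: mu_integrableZ; exact: L2_integrable_sqr.
Qed.

Lemma L2B f g : L2 V f -> L2 V g -> L2 V (fun x => f x - g x).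
Proof.
move=> Lf Lg; rewrite (_ : (fun x => _) = (fun x => f x + (-1) * g x)).
  by apply: L2D => //; exact: L2Z.
by apply/funext => x; ring.
Qed.

Lemma ipC f g : ip V f g = ip V g f.
Proof. by rewrite /ip; congr (fine (muint _ _)); apply/funext => x; rewrite mulrC. Qed.

Lemma ipDl f g h : L2 V f -> L2 V g -> L2 V h ->
  ip V (fun x => f x + g x) h = ip V f h + ip V g h.
Proof.
move=> Lf Lg Lh; rewrite -meanD; [|exact: L2_integrableM..].
by rewrite /ip /mean; congr (fine (muint _ _)); apply/funext => x; rewrite mulrDl.
Qed.

Lemma ipZl a f g : L2 V f -> L2 V g -> ip V (fun x => a * f x) g = a * ip V f g.
Proof.
move=> Lf Lg; rewrite -meanZ; last exact: L2_integrableM.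
by rewrite /ip /mean; congr (fine (muint _ _)); apply/funext => x; rewrite mulrA.
Qed.

Lemma ipDr f g h : L2 V f -> L2 V g -> L2 V h ->
  ip V h (fun x => f x + g x) = ip V h f + ip V h g.
Proof. by move=> Lf Lg Lh; rewrite ipC ipDl // !(ipC h). Qed.

Lemma ipZr a f g : L2 V f -> L2 V g -> ip V g (fun x => a * f x) = a * ip V g f.
Proof. by move=> Lf Lg; rewrite ipC ipZl // ipC. Qed.

Lemma ip_ge0 f : 0 <= ip V f f.
Proof. by apply: mean_ge0 => x; rewrite -expr2 sqr_ge0. Qed.

(** The quadratic form [|a f + b g|^2] is nonnegative for all real [a] and [b]; suitable values give
    the inequality. *)
Lemma ip_CauchySchwarz f g : L2 V f -> L2 V g -> ip V f g ^+ 2 <= ip V f f * ip V g g.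
Proof.
move=> Lf Lg.
have H a b : 0 <= a ^+ 2 * ip V f f + 2 * a * b * ip V f g + b ^+ 2 * ip V g g.
  have := ip_ge0 (fun x => a * f x + b * g x).
  have La := L2Z a Lf; have Lb := L2Z b Lg; have Lab := L2D La Lb.
  rewrite ipDl // !ipDr // !ipZl // !ipZr // (ipC g f).
  set p := ip V f f; set q := ip V f g; set r := ip V g g => Hp.
  by apply: le_trans Hp _; rewrite le_eqVlt; apply/orP; left; apply/eqP; ring.
have Hf := ip_ge0 f; have Hg := ip_ge0 g.
have [fg0|fg0] := eqVneq (ip V g g) 0.
  have [->|n0] := eqVneq (ip V f g) 0; first by rewrite expr0n mulr_ge0.
  (* For [|g| = 0] the form is affine in [b], and this value of [b] would make it equal to -1. *)
  have := H 1 (- (ip V f f + 1) / (2 * ip V f g)).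
  have -> : 2 * 1 * (- (ip V f f + 1) / (2 * ip V f g)) * ip V f g = - (ip V f f + 1).
    by field.
  by rewrite fg0 mulr0 addr0 expr1n mul1r => ?; lra.
have gp : 0 < ip V g g by rewrite lt_neqAle eq_sym fg0.
(* The minimizing direction, scaled by [|g|^2] to avoid a quotient. *)
have := H (ip V g g) (- ip V f g).
have -> : ip V g g ^+ 2 * ip V f f + 2 * ip V g g * - ip V f g * ip V f g
  + (- ip V f g) ^+ 2 * ip V g g = ip V g g * (ip V f f * ip V g g - ip V f g ^+ 2) by ring.
by rewrite pmulr_rge0 // subr_ge0.
Qed.

Lemma normr_ip_le f g : L2 V f -> L2 V g ->
  `|ip V f g| <= Num.sqrt (ip V f f) * Num.sqrt (ip V g g).
Proof.
move=> Lf Lg; rewrite -sqrtrM ?ip_ge0 // -sqrtr_sqr ler_wsqrtr //.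
exact: ip_CauchySchwarz.
Qed.

(** Writing each sequence as its limit plus an error leaves three error terms, all bounded by
    Cauchy-Schwarz. This carries inequalities from test functions to the closure of L. *)
Lemma ip_cvg (fk gk : nat -> R -> R) f g :
  (forall k, L2 V (fk k)) -> (forall k, L2 V (gk k)) -> L2 V f -> L2 V g ->
  (fun k => muint V (fun x => (fk k x - f x) ^+ 2)) @ \oo --> 0%E ->
  (fun k => muint V (fun x => (gk k x - g x) ^+ 2)) @ \oo --> 0%E ->
  ip V (fk k) (gk k) @[k --> \oo] --> ip V f g.
Proof.
move=> Lfk Lgk Lf Lg.
have L0 (hk : nat -> R -> R) h :
    (fun k => muint V (fun x => (hk k x - h x) ^+ 2)) @ \oo --> 0%E ->
    Num.sqrt (ip V (fun x => hk k x - h x) (fun x => hk k x - h x)) @[k --> \oo] --> 0.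
  move=> /fine_cvgP[_ H]; rewrite -(sqrtr0 R).
  apply: (@continuous_cvg _ _ _ _ _ _ Num.sqrt); first exact: sqrt_continuous.
  by apply: cvg_trans H; apply: near_eq_cvg; near=> k => /=.
move=> /L0 fk0 /L0 gk0.
pose a k x := fk k x - f x; pose b k x := gk k x - g x.
have La k : L2 V (a k) by exact: L2B.
have Lb k : L2 V (b k) by exact: L2B.
have E k : ip V (fk k) (gk k) = ip V f g + (ip V f (b k) + ip V (a k) g + ip V (a k) (b k)).
  have -> : fk k = (fun x => f x + a k x) by apply/funext => x; rewrite /a addrC subrK.
  have -> : gk k = (fun x => g x + b k x) by apply/funext => x; rewrite /b addrC subrK.
  have Lgb := L2D Lg (Lb k).
  by rewrite (ipDl Lf (La k) Lgb) (ipDr Lg (Lb k) Lf)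
    (ipDr Lg (Lb k) (La k)); ring.
rewrite (_ : (fun k => _) = (fun k => ip V f g +
  (ip V f (b k) + ip V (a k) g + ip V (a k) (b k)))); last exact/funext.
rewrite -[X in _ --> X]addr0; apply: cvgD; first exact: cvg_cst.
have Z (u v : nat -> R -> R) : (forall k, L2 V (u k)) -> (forall k, L2 V (v k)) ->
    Num.sqrt (ip V (u k) (u k)) * Num.sqrt (ip V (v k) (v k)) @[k --> \oo] --> 0 ->
    ip V (u k) (v k) @[k --> \oo] --> 0.
  move=> Lu Lv H; apply/norm_cvg0P.
  apply: (squeeze_cvgr _ (cvg_cst 0) H); near=> k.
  by rewrite normr_ge0 normr_ip_le.
rewrite -[X in _ --> X]addr0 -[X in _ --> X + _]addr0; apply: cvgD; first apply: cvgD.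
- apply: (Z (fun=> f)) => //; rewrite -(mulr0 (Num.sqrt (ip V f f))).
  by apply: cvgM; [exact: cvg_cst|exact: gk0].
- apply: (Z _ (fun=> g)) => //; rewrite -(mul0r (Num.sqrt (ip V g g))).
  by apply: cvgM; [exact: fk0|exact: cvg_cst].
- by apply: Z => //; rewrite -(mulr0 0); apply: cvgM.
Unshelve. all: by end_near. Qed.

Lemma mean_gt0 h x0 : mu_integrable h -> continuous h -> 0 < Zc V -> (forall x, 0 <= h x) ->
  0 < h x0 -> 0 < mean h.
Proof.
move=> Ih ch Z0 h0 hx0; rewrite -lte_fin -muintE //.
apply: (@integral_continuous_gt0 R (fun x => h x * dens V x) x0).
- by move=> x; apply: cvgM; [exact: ch|exact: dens_continuous].
- by move=> x; rewrite mulr_ge0 ?dens_ge0.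
- by rewrite mulr_gt0 // divr_gt0 // expR_gt0.
Qed.

End WeightedIntegral.

(** * Limits of Lebesgue integrals and calculus with explicit derivatives *)

Lemma is_derive_continuous (R : realType) (f df : R -> R) :
  (forall x, is_derive x (1 : R) f (df x)) -> continuous f.
Proof.
move=> H x; apply/differentiable_continuous/derivable1_diffP.
exact: (@ex_derive _ _ _ _ _ _ _ (H x)).
Qed.

(** The majorant behind all integrability against [mu]: a function of polynomial growth times [dens]
    is dominated by a multiple of it. Evenness reduces it to the half-line. *)
Lemma integrable_oneDsqrV (R : realType) :
  (@lebesgue_measure R).-integrable [set: R] (EFin \o (fun x : R => (1 + x ^+ 2)^-1)).
Proof.
have p0 (x : R) : 0 <= (1 + x ^+ 2)^-1 by rewrite invr_ge0 addr_ge0 ?sqr_ge0.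
have c : continuous (fun x : R => (1 + x ^+ 2)^-1) by exact: continuous_oneDsqrV.
apply/integrableP; split.
  by apply/measurable_EFinP; exact: continuous_measurable_fun.
rewrite (_ : \int[_]_x _ = \int[@lebesgue_measure R]_x ((1 + x ^+ 2)^-1)%:E)%E; last first.
  by apply: eq_integral => x _ /=; rewrite ger0_norm.
rewrite ge0_symfun_integralT //; last by move=> x /=; rewrite sqrrN.
rewrite -set_itvcy (integral0y_oneDsqr R) -EFinM; exact: ltry.
Qed.

(** Dominated convergence with majorant [|g|]. Convergence of the sets is phrased as eventual
    membership, which covers intervals growing to the line as well as half-lines shrinking to the
    empty set. *)
Lemma cvg_Rintegral_sets (R : realType) (g : R -> R) (I : nat -> set R) (D : set R) :
  (@lebesgue_measure R).-integrable [set: R] (EFin \o g) ->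
  (forall n, measurable (I n)) -> measurable D ->
  (forall x, \forall n \near \oo, (x \in I n) = (x \in D)) ->
  \int[@lebesgue_measure R]_(x in I n) g x @[n --> \oo] -->
  \int[@lebesgue_measure R]_(x in D) g x.
Proof.
set lm := @lebesgue_measure R.
move=> Ig mI mD HI.
have mg : measurable_fun [set: R] g by apply/measurable_EFinP; case/integrableP: Ig.
have := @dominated_cvg _ _ _ lm setT measurableT
  (fun n : nat => (EFin \o g) \_ (I n)) ((EFin \o g) \_ D) (abse \o (EFin \o g)).
have H1 (n : nat) : measurable_fun [set: R] ((EFin \o g) \_ (I n)).
  by apply/(measurable_restrictT _ (mI n)); apply/measurable_EFinP/measurable_funTS.
have H2 (x : R) : [set: R] x -> ((EFin \o g) \_ (I n)) x @[n --> \oo] --> ((EFin \o g) \_ D) x.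
  by move=> _; apply: cvg_near_cst; apply: filterS (HI x) => n; rewrite !patchE => ->.
have H3 (x : R) : [set: R] x -> (abse \o (EFin \o g)) x \is a fin_num by [].
have H4 (n : nat) (x : R) : [set: R] x ->
    (`|((EFin \o g) \_ (I n)) x| <= (abse \o (EFin \o g)) x)%E.
  by move=> _; rewrite patchE; case: ifP => // _; rewrite abse0; exact: abse_ge0.
move=> /(_ H1 H2 H3 (integrable_abse Ig) H4).
rewrite -integral_mkcond.
have -> : (\int[lm]_(x in D) (EFin \o g) x)%E = (\int[lm]_(x in D) g x)%:E.
  rewrite /Rintegral fineK //; apply: integrable_fin_num => //.
  exact: integrableS Ig.
move=> /fine_cvgP[_]; apply: cvg_trans; apply: near_eq_cvg; near=> n.
by rewrite /= -integral_mkcond.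
Unshelve. all: by end_near. Qed.

Section DerivativeRules.
Variable R : realType.
Implicit Types f g df dg : R -> R.

(** The derivative is given as an explicit function, so that formulas for it can be rewritten
    without going through [derive1]. *)
Definition has_derivative f df : Prop := forall x, is_derive x (1 : R) f (df x).

Lemma has_derivative_continuous f df : has_derivative f df -> continuous f.
Proof. exact: is_derive_continuous. Qed.

Lemma continuous_add f g : continuous f -> continuous g -> continuous (fun x => f x + g x).
Proof. by move=> cf cg x; apply: cvgD; [exact: cf|exact: cg]. Qed.

Lemma continuous_mul f g : continuous f -> continuous g -> continuous (fun x => f x * g x).
Proof. by move=> cf cg x; apply: cvgM; [exact: cf|exact: cg]. Qed.

Lemma has_derivative_eq f df dg :
  has_derivative f df -> (forall x, df x = dg x) -> has_derivative f dg.
Proof. by move=> H E x; rewrite -E. Qed.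

Lemma has_derivativeD f g df dg : has_derivative f df -> has_derivative g dg ->
  has_derivative (fun x => f x + g x) (fun x => df x + dg x).
Proof. by move=> Hf Hg x; have := Hf x; have := Hg x => *; exact: is_deriveD. Qed.

Lemma has_derivativeM f g df dg : has_derivative f df -> has_derivative g dg ->
  has_derivative (fun x => f x * g x) (fun x => df x * g x + f x * dg x).
Proof.
move=> Hf Hg x; have := Hf x; have := Hg x => dgx dfx.
have := is_deriveM dfx dgx => H; apply: is_derive_eq.
by rewrite /GRing.scale /= addrC (mulrC (g x)).
Qed.

Lemma has_derivative_cst (c : R) : has_derivative (fun=> c) (fun=> 0).
Proof. by move=> x; exact: is_derive_cst. Qed.

Lemma has_derivative_id : has_derivative (fun x => x) (fun=> 1).
Proof. by move=> x; exact: is_derive_id. Qed.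

Lemma has_derivativeZ (a : R) f df : has_derivative f df ->
  has_derivative (fun x => a * f x) (fun x => a * df x).
Proof.
move=> H; have := has_derivativeM (has_derivative_cst a) H.
by move/has_derivative_eq; apply => x; rewrite mul0r add0r.
Qed.

Lemma has_derivativeX f df n : has_derivative f df ->
  has_derivative (fun x => f x ^+ n.+1) (fun x => n.+1%:R * f x ^+ n * df x).
Proof.
move=> H x; have := is_deriveX n.+1 (H x); rewrite /GRing.scale /= => H1.
by rewrite (_ : (fun x => f x ^+ n.+1) = f ^+ n.+1) //; apply/funext => y; rewrite fctE.
Qed.

Lemma has_derivative_expR f df : has_derivative f df ->
  has_derivative (fun x => expR (f x)) (fun x => df x * expR (f x)).
Proof.
move=> H x; have Hx := H x.
have := @is_derive1_comp R expR f x _ _ (is_derive_expR (f x)) Hx.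
by rewrite mulrC; apply.
Qed.

Lemma has_derivative_mean_value f df a b : has_derivative f df -> a <= b ->
  exists2 c : R, a <= c <= b & f b - f a = df c * (b - a).
Proof.
move=> H ab; have [|c] := MVT_segment ab (fun x _ => H x).
  exact/continuous_subspaceT/has_derivative_continuous.
by rewrite in_itv /= => cab E; exists c.
Qed.

End DerivativeRules.

(** * Decay of the density and integration by parts for a uniformly convex potential *)

Section ConfiningPotential.
Variables (R : realType) (V : R -> R) (r : R).
Hypothesis sV : smooth V.
Hypothesis r0 : 0 < r.
Hypothesis HV : forall x, r <= derive1n 2 V x.
Notation lm := (@lebesgue_measure R).
Notation V' := (derive1 V).
Notation V'' := (derive1n 2 V).

Lemma smooth_has_derivative1 : has_derivative V V'.
Proof. by move=> x; rewrite derive1E; apply/derivableP; exact: (@sV 0%N x). Qed.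

Lemma smooth_has_derivative2 : has_derivative V' V''.
Proof. by move=> x; rewrite derive1nS derive1E; apply/derivableP; exact: (@sV 1%N x). Qed.

Lemma V_continuous : continuous V.
Proof. exact: has_derivative_continuous smooth_has_derivative1. Qed.

Lemma V'_continuous : continuous V'.
Proof. exact: has_derivative_continuous smooth_has_derivative2. Qed.

Lemma V''_continuous : continuous V''.
Proof.
move=> x; apply/differentiable_continuous/derivable1_diffP; exact: (@sV 2%N x).
Qed.
Local Notation cV := V_continuous.

Lemma V'_growth a b : a <= b -> r * (b - a) <= V' b - V' a.
Proof.
move=> ab; have [c _ ->] := has_derivative_mean_value smooth_has_derivative2 ab.
by rewrite ler_wpM2r ?subr_ge0.
Qed.

(** The difference [psi] of the two sides has derivative [V' y - V' 0 - r y], which has the sign of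
    [y] by the growth of [V']; so [psi] is minimal at 0, where it vanishes. *)
Lemma V_ge x : V 0 + V' 0 * x + r / 2 * x ^+ 2 <= V x.
Proof.
pose psi y := V y - (V 0 + V' 0 * y + r / 2 * y ^+ 2).
have dpsi : has_derivative psi (fun y => V' y - V' 0 - r * y).
  have D1 := has_derivativeZ (V' 0) (@has_derivative_id R).
  have D2 := has_derivativeZ (r / 2) (has_derivativeX 1 (@has_derivative_id R)).
  have D3 := has_derivativeD (has_derivativeD (has_derivative_cst (V 0)) D1) D2.
  have := has_derivativeD smooth_has_derivative1 (has_derivativeZ (-1) D3).
  rewrite (_ : (fun x => _) = psi); last by apply/funext => y; rewrite /psi; ring.
  by move/has_derivative_eq; apply => y; field.
suff : psi 0 <= psi x by rewrite /psi; lra.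
have [x0|x0] := leP 0 x.
  have [c /andP[c0 cx] E] := has_derivative_mean_value dpsi x0.
  rewrite -subr_ge0 E.
  by apply: mulr_ge0; [have := V'_growth c0|]; lra.
have [c /andP[c0 cx] E] := has_derivative_mean_value dpsi (ltW x0).
rewrite -subr_le0 E.
by apply: mulr_le0_ge0; [have := V'_growth cx|]; lra.
Qed.

(** Half of the quadratic term absorbs the linear one; what remains is the square
    [(r x / 2 + V' 0)^2 / r]. *)
Lemma V_ge_sqr : exists c : R, forall x, c + r / 4 * (1 + x ^+ 2) <= V x.
Proof.
exists (V 0 - r / 4 - V' 0 ^+ 2 / r) => x; apply: le_trans (V_ge x).
rewrite -subr_ge0.
have -> : V 0 + V' 0 * x + r / 2 * x ^+ 2 -
   (V 0 - r / 4 - V' 0 ^+ 2 / r + r / 4 * (1 + x ^+ 2)) =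
   (r * x / 2 + V' 0) ^+ 2 / r by field; rewrite gt_eqF.
by rewrite divr_ge0 ?sqr_ge0 // ltW.
Qed.

Lemma ge1_oneDsqr (x : R) : 1 <= 1 + x ^+ 2. Proof. by rewrite lerDl sqr_ge0. Qed.

(** With [s = r / 4 (1 + x^2)], the exponential series gives [s^(k+1) / (k+1)! <= e^s], while
    [e^(-V) <= e^(-c) e^(-s)]. Raising the exponent from [k] to [k + 1] is harmless since
    [1 + x^2 >= 1]. *)
Lemma expRNV_decay k : exists C : R, forall x, (1 + x ^+ 2) ^+ k * expR (- V x) <= C.
Proof.
have [c Hc] := V_ge_sqr.
pose C0 := (k.+1)`!%:R / (r / 4) ^+ k.+1 : R.
have F0 : 0 < (k.+1)`!%:R :> R by rewrite ltr0n fact_gt0.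
exists (C0 * expR (- c)) => x.
pose s := r / 4 * (1 + x ^+ 2).
have x2 := sqr_ge0 x.
have s0 : 0 < s by rewrite /s mulr_gt0 ?divr_gt0 //; lra.
have H : (1 + x ^+ 2) ^+ k <= C0 * expR s.
  apply: (@le_trans _ _ ((1 + x ^+ 2) ^+ k.+1)).
    by rewrite ler_weXn2l // ge1_oneDsqr.
  have -> : (1 + x ^+ 2) ^+ k.+1 = C0 * (s ^+ k.+1 / (k.+1)`!%:R).
    have q0 : (r / 4) ^+ k.+1 != 0 by rewrite gt_eqF // exprn_gt0 // divr_gt0.
    rewrite /C0 /s [(r / 4 * _) ^+ _]exprMn.
    have F1 : (k.+1)`!%:R != 0 :> R by rewrite gt_eqF.
    move: ((r / 4) ^+ k.+1) ((1 + x ^+ 2) ^+ k.+1) ((k.+1)`!%:R : R) q0 F1 => q y z q0 z0.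
    by field; rewrite q0 z0.
  rewrite ler_wpM2l ?divr_ge0 ?exprn_ge0 ?divr_ge0 ?(ltW F0) ?(ltW r0) //.
  by apply: le_trans (expR_ge1Dxn k (ltW s0)); rewrite lerDr.
apply: (@le_trans _ _ (C0 * expR s * expR (- V x))).
  by rewrite ler_wpM2r ?expR_ge0.
have C00 : 0 <= C0 by rewrite divr_ge0 ?exprn_ge0 ?divr_ge0 ?(ltW F0) ?(ltW r0).
by rewrite -mulrA -expRD ler_wpM2l // ler_expR; have := Hc x; rewrite -/s; lra.
Qed.

Lemma dens_decay k : exists C : R, forall x, (1 + x ^+ 2) ^+ k * dens V x <= C.
Proof.
have [C HC] := expRNV_decay k; exists (C / Zc V) => x.
by rewrite mulrA ler_wpM2r ?invr_ge0 ?Zc_ge0.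
Qed.

(** [Zc] is a [fine], which would be 0 for an infinite integral; so integrability of [e^(-V)] is
    established first, from the decay with [k = 1]. *)
Lemma Zc_gt0 : 0 < Zc V.
Proof.
have c : continuous (fun x => expR (- V x)).
  have D := has_derivative_expR (has_derivativeZ (-1) smooth_has_derivative1).
  rewrite (_ : (fun x => _) = (fun x => expR (-1 * V x))).
    exact: has_derivative_continuous D.
  by apply/funext => x; rewrite mulN1r.
have [C HC] := expRNV_decay 1.
have IC : lm.-integrable [set: R]
    (fun x : R => (C%:E * (EFin \o (fun x : R => (1 + x ^+ 2)^-1)%R) x)%E).
  exact: integrableZl (integrable_oneDsqrV R).
have I : lm.-integrable [set: R] (EFin \o (fun x => expR (- V x))).
  apply: (le_integrable _ _ _ IC) => //.
    by apply/measurable_EFinP; exact: continuous_measurable_fun.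
  have H (x : R) : `|expR (- V x)| <= `|C * (1 + x ^+ 2)^-1|.
    rewrite ger0_norm ?expR_ge0 //; apply: le_trans (ler_norm _).
    have xp : 0 < 1 + x ^+ 2 by have := ge1_oneDsqr x; lra.
    by rewrite ler_pdivlMr // mulrC; have := HC x; rewrite expr1.
  by move=> x _; have := H x; rewrite -lee_fin.
rewrite -lte_fin /Zc fineK; last exact: integrable_fin_num I.
apply: (@integral_continuous_gt0 R _ 0) => //; exact: expR_gt0.
Qed.

(** The working class of functions: closed under sums and products, integrable against [mu], and
    without boundary terms at infinity. Growth is measured in powers of [1 + x^2 >= 1], so that
    bounds are monotone in the exponent. *)
Definition polygrowth (h : R -> R) : Prop :=
  continuous h /\ exists (C : R) k, forall x, `|h x| <= C * (1 + x ^+ 2) ^+ k.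

Lemma polygrowth_bounded (h : R -> R) (C : R) :
  continuous h -> (forall x, `|h x| <= C) -> polygrowth h.
Proof. by move=> ch hC; split => //; exists C, 0 => x; rewrite expr0 mulr1. Qed.

Lemma polygrowth_cst (c : R) : polygrowth (fun=> c).
Proof. by apply: (@polygrowth_bounded _ `|c|) => // x; exact: cvg_cst. Qed.

Lemma polygrowth_id : polygrowth (fun x => x).
Proof.
split; first by move=> x; exact: cvg_id.
exists 1, 1 => x; rewrite mul1r expr1 ler_norml.
by have := sqr_ge0 (x - 1); have := sqr_ge0 (x + 1); rewrite !sqrrD; nra.
Qed.

Lemma polygrowthD f g : polygrowth f -> polygrowth g -> polygrowth (fun x => f x + g x).
Proof.
move=> [cf [Cf [kf Hf]]] [cg [Cg [kg Hg]]]; split.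
  by move=> x; apply: cvgD; [exact: cf|exact: cg].
exists (Cf + Cg), (kf + kg)%N => x; have x1 := ge1_oneDsqr x.
have Cf0 : 0 <= Cf by have := Hf 0; rewrite expr0n addr0 expr1n mulr1; exact: le_trans.
have Cg0 : 0 <= Cg by have := Hg 0; rewrite expr0n addr0 expr1n mulr1; exact: le_trans.
apply: le_trans (ler_normD _ _) _; rewrite mulrDl; apply: lerD.
  by apply: le_trans (Hf x) _; rewrite ler_wpM2l // ler_weXn2l // leq_addr.
by apply: le_trans (Hg x) _; rewrite ler_wpM2l // ler_weXn2l // leq_addl.
Qed.

Lemma polygrowthM f g : polygrowth f -> polygrowth g -> polygrowth (fun x => f x * g x).
Proof.
move=> [cf [Cf [kf Hf]]] [cg [Cg [kg Hg]]]; split.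
  by move=> x; apply: cvgM; [exact: cf|exact: cg].
exists (Cf * Cg), (kf + kg)%N => x; have x1 := ge1_oneDsqr x.
by rewrite normrM exprD mulrACA; apply: ler_pM.
Qed.

Lemma polygrowthZ a f : polygrowth f -> polygrowth (fun x => a * f x).
Proof. exact: polygrowthM (polygrowth_cst a). Qed.

Lemma polygrowthX f n : polygrowth f -> polygrowth (fun x => f x ^+ n).
Proof.
move=> Hf; elim: n => [|n IH].
  by rewrite (_ : (fun x => _) = fun=> 1); [exact: polygrowth_cst|apply/funext => x].
rewrite (_ : (fun x => _) = fun x => f x * f x ^+ n); first exact: polygrowthM.
by apply/funext => x; rewrite exprS.
Qed.

(** One more power of [1 + x^2] than the growth of [h] is taken from the decay of [dens]. *)
Lemma polygrowth_decay h : polygrowth h ->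
  exists2 C : R, 0 <= C & forall x, `|h x * dens V x| <= C * (1 + x ^+ 2)^-1.
Proof.
move=> [_ [C [k HC]]]; have [D HD] := dens_decay k.+1.
have C0 : 0 <= C by have := HC 0; rewrite expr0n addr0 expr1n mulr1; exact: le_trans.
have D0 : 0 <= D.
  apply: le_trans (HD 0); rewrite expr0n addr0 expr1n mul1r; exact: dens_ge0.
exists (C * D); first exact: mulr_ge0.
move=> x; have x1 := ge1_oneDsqr x.
have xp : 0 < 1 + x ^+ 2 by lra.
rewrite ler_pdivlMr // normrM (ger0_norm (dens_ge0 _ _)).
apply: (@le_trans _ _ (C * ((1 + x ^+ 2) ^+ k.+1 * dens V x))); last exact: ler_wpM2l.
rewrite (_ : C * _ = C * (1 + x ^+ 2) ^+ k * (dens V x * (1 + x ^+ 2))); last first.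
  by rewrite exprSr; ring.
by rewrite -[leLHS]mulrA; apply: ler_wpM2r => //; rewrite mulr_ge0 ?dens_ge0 // ltW.
Qed.

Lemma polygrowth_integrable h : polygrowth h -> mu_integrable V h.
Proof.
move=> Hh; have [C C0 HC] := polygrowth_decay Hh.
have IC : lm.-integrable [set: R]
    (fun x : R => (C%:E * (EFin \o (fun x : R => (1 + x ^+ 2)^-1)%R) x)%E).
  exact: integrableZl (integrable_oneDsqrV R).
apply: (le_integrable _ _ _ IC) => //.
  apply/measurable_EFinP/measurable_funM; last exact: dens_measurable cV.
  by apply: continuous_measurable_fun; case: Hh.
have H (x : R) : `|h x * dens V x| <= `|C * (1 + x ^+ 2)^-1|.
  by apply: le_trans (HC x) _; rewrite ler_norm.
by move=> x _; have := H x; rewrite -lee_fin.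
Qed.

Lemma polygrowth_L2 h : polygrowth h -> L2 V h.
Proof.
move=> Hh; apply: integrable_sqr_L2.
  by apply: continuous_measurable_fun; case: Hh.
exact/polygrowth_integrable/polygrowthX.
Qed.

Lemma has_derivative_dens : has_derivative (dens V) (fun x => - V' x * dens V x).
Proof.
have D0 := has_derivativeZ (-1) smooth_has_derivative1.
have D1 := has_derivativeM (has_derivative_expR D0) (has_derivative_cst (Zc V)^-1).
rewrite (_ : (fun x => _) = dens V) in D1.
  by apply: has_derivative_eq D1 _ => x; rewrite /dens !mulN1r; ring.
by apply/funext => x; rewrite mulN1r.
Qed.

(** Boundary terms vanish; the condition on [|u n|] treats both ends of the line at once. *)
Lemma polygrowth_cvg0 h (u : nat -> R) : polygrowth h ->
  (forall n, n.+1%:R <= `|u n|) -> h (u n) * dens V (u n) @[n --> \oo] --> 0.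
Proof.
move=> Hh Hu; have [C C0 HC] := polygrowth_decay Hh.
apply/norm_cvg0P; apply: (squeeze_cvgr (f := fun=> 0) (h := fun n => C * harmonic n)).
- near=> n; rewrite normr_ge0 /=; apply: le_trans (HC _) _.
  rewrite ler_wpM2l // /harmonic lef_pV2 ?posrE ?ltr0n //; last first.
    by have := ge1_oneDsqr (u n); lra.
  rewrite -(real_normK (num_real (u n))).
  have := Hu n; have := sqr_ge0 (`|u n| - 1).
  by rewrite sqrrB expr1n mulr1; have := normr_ge0 (u n); lra.
- exact: cvg_cst.
- by rewrite -(mulr0 C); apply: cvgM; [exact: cvg_cst|exact: cvg_harmonic].
Unshelve. all: by end_near. Qed.

Lemma cvg_mean_itv h : polygrowth h ->
  \int[lm]_(x in `[- n%:R, n%:R]) (h x * dens V x) @[n --> \oo] --> mean V h.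
Proof.
move=> Hh; have := @cvg_Rintegral_sets R (fun x => h x * dens V x)
  (fun n => `[- n%:R, n%:R]%classic) setT (polygrowth_integrable Hh).
apply => //.
move=> x; near=> n; rewrite in_setT mem_set //= in_itv /= -ler_norml.
near: n; exact: nbhs_infty_ger.
Unshelve. all: by end_near. Qed.

(* One-sided, so that [w' - V' * w] need not be integrable. *)
Lemma mean_ge0_by_parts (w w' G : R -> R) :
  polygrowth w -> polygrowth G -> continuous w' -> has_derivative w w' ->
  (forall x, 0 <= w' x - V' x * w x + G x) -> 0 <= mean V G.
Proof.
move=> Hw HG cw' dw pos.
pose F x := w x * dens V x.
have dF : has_derivative F (fun x => (w' x - V' x * w x) * dens V x).
  have := has_derivativeM dw has_derivative_dens.
  by move/has_derivative_eq; apply => x; ring.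
have cF := has_derivative_continuous dF.
have cdF : continuous (fun x => (w' x - V' x * w x) * dens V x).
  move=> x; apply: cvgM; last exact: dens_continuous cV x.
  apply: cvgB; first exact: cw'.
  by apply: cvgM; [exact: V'_continuous|case: Hw => + _; apply].
have cG : continuous (fun x => G x * dens V x).
  by move=> x; apply: cvgM; [case: HG => + _; apply|exact: dens_continuous cV x].
(* The integral of [(w' - V' w) dens] over the interval is the increment of [F], and adding [G dens]
   makes the integrand nonnegative. The bound [n + 1] keeps the interval nondegenerate. *)
have H (n : nat) : F (- n.+1%:R) - F n.+1%:R <=
    \int[lm]_(x in `[- n.+1%:R, n.+1%:R]) (G x * dens V x).
  have nn : - n.+1%:R < n.+1%:R :> R by rewrite gtrN // ltr0n.
  have := continuous_FTC2 nn (continuous_subspaceT cdF).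
  move=> /(_ F) E.
  rewrite -opprB -subr_ge0 opprK.
  have -> : F n.+1%:R - F (- n.+1%:R) =
      \int[lm]_(x in `[- n.+1%:R, n.+1%:R]) ((w' x - V' x * w x) * dens V x).
    rewrite /Rintegral E //; last first.
      by move=> x _; rewrite derive1E (@derive_val _ _ _ _ _ _ _ (dF x)).
    split; first by move=> x _; exact: (@ex_derive _ _ _ _ _ _ _ (dF x)).
    - exact/cvg_at_right_filter/cF.
    - exact/cvg_at_left_filter/cF.
  have ci (f : R -> R) : continuous f -> lm.-integrable `[- n.+1%:R, n.+1%:R] (EFin \o f).
    move=> cf; apply: continuous_compact_integrable; first exact: segment_compact.
    exact: continuous_subspaceT.
  rewrite -RintegralD //; [|exact: ci..].
  apply: Rintegral_ge0 => x _; rewrite -mulrDl addrC; apply: mulr_ge0; last exact: dens_ge0.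
  by have := pos x; rewrite addrC.
have HF (u : nat -> R) : (forall n, n.+1%:R <= `|u n|) -> F (u n) @[n --> \oo] --> 0.
  by move=> Hu; exact: polygrowth_cvg0.
have HF1 : F (- n.+1%:R) @[n --> \oo] --> 0 by apply: HF => n; rewrite normrN ler_norm.
have HF2 : F n.+1%:R @[n --> \oo] --> 0 by apply: HF => n; rewrite ler_norm.
apply: (ler_cvg_to _ (cvg_comp _ _ (@cvg_addnr 1) (cvg_mean_itv HG))).
- by have := cvgB HF1 HF2; rewrite subr0; apply.
- by near=> n; have := H n; rewrite /= addn1.
Unshelve. all: by end_near. Qed.

(** The one-sided version is applied to [w] and to [-w]: here [w' - V' w] has polynomial growth and
    can itself serve, up to sign, as [G]. *)
Lemma mean_by_parts (w w' : R -> R) :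
  polygrowth w -> continuous w' -> has_derivative w w' ->
  polygrowth (fun x => w' x - V' x * w x) ->
  mean V (fun x => w' x - V' x * w x) = 0.
Proof.
move=> Hw cw' dw HG; apply/eqP; rewrite eq_le; apply/andP; split.
- rewrite -oppr_ge0 -mulN1r -meanZ; last exact: polygrowth_integrable.
  apply: mean_ge0_by_parts (polygrowthZ _ HG) cw' dw _ => // x.
  by rewrite mulN1r subrr.
- apply: (@mean_ge0_by_parts (fun x => -1 * w x) (fun x => -1 * w' x)) => //.
  + exact: polygrowthZ.
  + by move=> x; apply: cvgM; [exact: cvg_cst|exact: cw'].
  + exact: has_derivativeZ.
  + by move=> x; rewrite le_eqVlt; apply/orP; left; apply/eqP; ring.
Qed.

End ConfiningPotential.

Lemma continuous_bounded_itv (R : realType) (h : R -> R) (M : R) : continuous h ->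
  exists2 B : R, 0 <= B & forall x, `|x| <= M -> `|h x| <= B.
Proof.
move=> ch; have [M0|M0] := leP 0 M; last first.
  by exists 0 => // x /(le_lt_trans)/(_ M0); rewrite normr_lt0.
have ab : - M <= M by lra.
have cn : {within `[- M, M], continuous (fun x => `|h x|)}.
  by apply: continuous_subspaceT => x; apply: cvg_norm; exact: ch.
have [c _ Hc] := EVT_max ab cn.
by exists `|h c| => // x xM; apply: Hc; rewrite in_itv /= -ler_norml.
Qed.

(** * The adjoint operator A* and its norm estimates *)

Section LowerBound.
Variables (R : realType) (V : R -> R) (r : R).
Hypothesis sV : smooth V.
Hypothesis r0 : 0 < r.
Hypothesis HV : forall x, r <= derive1n 2 V x.
Notation lm := (@lebesgue_measure R).
Notation V' := (derive1 V).
Notation V'' := (derive1n 2 V).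
Let cV : continuous V := V_continuous sV.
Let dV := smooth_has_derivative1 sV.
Let dV' := smooth_has_derivative2 sV.
Let pInt := polygrowth_integrable sV r0 HV.
Let pL2 := polygrowth_L2 sV r0 HV.

(** Adjointness [<A* v, u> = <v, u'>], by parts on the product [v u]. The growth condition bears on
    [A* v] as a whole, which is known when [v] solves [A* v = f]. *)
Lemma mean_adjoint_mul (u du v dv : R -> R) :
  has_derivative u du -> has_derivative v dv -> continuous dv ->
  polygrowth u -> polygrowth du -> polygrowth v ->
  polygrowth (fun x => V' x * v x - dv x) ->
  mean V (fun x => (V' x * v x - dv x) * u x) = mean V (fun x => v x * du x).
Proof.
move=> Du Dv cdv pu pdu pv pA.
have E : (fun x => dv x * u x + v x * du x - V' x * (v x * u x)) =
    (fun x => v x * du x + -1 * ((V' x * v x - dv x) * u x)).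
  by apply/funext => x; ring.
have := @mean_by_parts R V r sV r0 HV (fun x => v x * u x) _ (polygrowthM pv pu)
  _ (has_derivativeM Dv Du).
rewrite E meanD; [|exact/pInt/polygrowthM|exact/pInt/polygrowthZ/polygrowthM].
rewrite meanZ; last exact/pInt/polygrowthM.
move=> H; apply/esym/eqP; rewrite -subr_eq0 -mulN1r; apply/eqP; apply: H.
- apply: continuous_add; apply: continuous_mul => //.
  + exact: pu.1.
  + exact: pv.1.
  + exact: pdu.1.
- by apply: polygrowthD; [exact/polygrowthM|exact/polygrowthZ/polygrowthM].
Qed.

(** For [w = s V' v^2] one finds [w' - V' w = s (V'' v^2 + v'^2 - (A* v)^2)], the integrated form of
    the commutation relation. It is stated as an inequality because [V'' v^2] has no growth bound
    when [V''] is unbounded; [s = 1] serves the lower estimate and [s = -1] the upper one. *)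
Lemma mean_ge0_adjoint_sqr (s : R) (G v dv : R -> R) :
  has_derivative v dv -> continuous dv ->
  polygrowth v -> polygrowth (fun x => V' x * v x) -> polygrowth G ->
  (forall x, 0 <= s * (V'' x * v x ^+ 2 + dv x ^+ 2 - (V' x * v x - dv x) ^+ 2) + G x) ->
  0 <= mean V G.
Proof.
move=> Dv cdv pv pVv pG pos.
have [cv _] := pv.
apply: (@mean_ge0_by_parts R V r sV r0 HV (fun x => s * (V' x * v x * v x))
  (fun x => s * ((V'' x * v x + V' x * dv x) * v x + V' x * v x * dv x))) => //.
- exact/polygrowthZ/polygrowthM.
- have c1 := V'_continuous sV; have c2 := V''_continuous sV.
  apply: continuous_mul; first by move=> x; exact: cvg_cst.
  by apply: continuous_add; apply: continuous_mul => //;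
    [apply: continuous_add|]; apply: continuous_mul.
- exact: (has_derivativeZ s (has_derivativeM (has_derivativeM dV' Dv) Dv)).
- move=> x; apply: le_trans (pos x) _; rewrite le_eqVlt; apply/orP; left; apply/eqP; ring.
Qed.

Lemma polygrowth_adjoint_sqr (v dv : R -> R) : polygrowth dv -> polygrowth (fun x => V' x * v x) ->
  polygrowth (fun x => (V' x * v x - dv x) ^+ 2).
Proof.
move=> pdv pVv; rewrite (_ : (fun x => _) = (fun x => (V' x * v x + -1 * dv x) ^+ 2)).
  by apply/polygrowthX/polygrowthD => //; exact: polygrowthZ.
by apply/funext => x; rewrite mulN1r.
Qed.

Lemma mean_adjoint_sqr_ge (v dv : R -> R) :
  has_derivative v dv -> continuous dv ->
  polygrowth v -> polygrowth dv -> polygrowth (fun x => V' x * v x) ->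
  mean V (fun x => dv x ^+ 2) + r * mean V (fun x => v x ^+ 2) <=
  mean V (fun x => (V' x * v x - dv x) ^+ 2).
Proof.
move=> Dv cdv pv pdv pVv.
have pA := polygrowth_adjoint_sqr pdv pVv.
have pdv2 := polygrowthX 2 pdv; have pv2 := polygrowthZ r (polygrowthX 2 pv).
have pG := polygrowthD pA (polygrowthZ (-1) (polygrowthD pdv2 pv2)).
rewrite -meanZ; last exact/pInt/polygrowthX.
rewrite -meanD; [|exact: pInt..].
rewrite -subr_ge0 -mulN1r -meanZ; last exact/pInt/polygrowthD.
rewrite -meanD; [|exact: pInt|exact/pInt/polygrowthZ/polygrowthD].
apply: (mean_ge0_adjoint_sqr (s := 1) Dv cdv pv pVv pG) => x.
rewrite (_ : _ + _ = (V'' x - r) * v x ^+ 2); last ring.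
by rewrite mulr_ge0 ?sqr_ge0 ?subr_ge0.
Qed.

Lemma mean_adjoint_sqr_le (K : R) (v dv : R -> R) : (forall x, V'' x <= K) ->
  has_derivative v dv -> continuous dv ->
  polygrowth v -> polygrowth dv -> polygrowth (fun x => V' x * v x) ->
  mean V (fun x => (V' x * v x - dv x) ^+ 2) <=
  mean V (fun x => dv x ^+ 2) + K * mean V (fun x => v x ^+ 2).
Proof.
move=> HK Dv cdv pv pdv pVv.
have pA := polygrowth_adjoint_sqr pdv pVv.
have pdv2 := polygrowthX 2 pdv; have pv2 := polygrowthZ K (polygrowthX 2 pv).
have pG := polygrowthD (polygrowthD pdv2 pv2) (polygrowthZ (-1) pA).
rewrite -meanZ; last exact/pInt/polygrowthX.
rewrite -meanD; [|exact: pInt..].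
rewrite -subr_ge0 -mulN1r -meanZ; last exact: pInt.
rewrite -meanD; [|exact/pInt/polygrowthD|exact/pInt/polygrowthZ].
apply: (mean_ge0_adjoint_sqr (s := -1) Dv cdv pv pVv pG) => x.
rewrite (_ : _ + _ = (K - V'' x) * v x ^+ 2); last ring.
by rewrite mulr_ge0 ?sqr_ge0 ?subr_ge0.
Qed.

(** Outside a compact set a bound on [V' v] becomes a bound on [v]. The threshold comes from
    [|V' x - V' 0| >= r |x|]. *)
Lemma normr_V'_ge1 : exists M : R, forall x, M < `|x| -> 1 <= `|V' x|.
Proof.
exists ((`|V' 0| + 1) / r) => x; rewrite ltr_pdivrMr // => H.
have := ler_norm (V' 0); have := ler_norm (- V' 0); rewrite normrN => h1 h2.
have [x0|x0] := leP 0 x.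
  rewrite (ger0_norm x0) in H.
  have := V'_growth sV HV x0; rewrite subr0 => h3.
  by apply: le_trans (ler_norm _); lra.
rewrite (ltr0_norm x0) in H.
have := V'_growth sV HV (ltW x0); rewrite sub0r => h3.
by rewrite -normrN; apply: le_trans (ler_norm _); lra.
Qed.

(** * Solving [A* v = f] for bounded centred [f] *)

Section Resolvent.
Variables (f : R -> R) (B : R).
Hypothesis cf : continuous f.
Hypothesis fB : forall x, `|f x| <= B.
Hypothesis f0 : mean V f = 0.

Let g x := f x * dens V x.
(** [Phi] tends to 0 at [-oo] by construction and at [+oo] because [f] has mean zero; [- Phi / dens]
    will be the solution of [A* v = f]. *)
Let Phi x := \int[lm]_(t in `]-oo, x]) g t.

Let pf : polygrowth f. Proof. exact: (polygrowth_bounded cf fB). Qed.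

Let Ig : lm.-integrable [set: R] (EFin \o g). Proof. exact: pInt. Qed.

Let dPhi : has_derivative Phi g.
Proof.
move=> x; have xu : x < x + 1 by rewrite ltrDl.
have cg : {for x, continuous g}.
  by apply: cvgM; [exact: cf|exact: dens_continuous cV x].
have Igx : lm.-integrable [set` Interval -oo%O (BRight (x + 1))] (EFin \o g).
  exact: integrableS Ig.
have [||//|d1 d2] := @continuous_FTC1 R g -oo%O x (x + 1) xu; first exact: Igx.
  by rewrite ltNyr.
by apply: DeriveDef => //; rewrite -derive1E.
Qed.

Let Phi_pinfty : Phi n.+1%:R @[n --> \oo] --> 0.
Proof.
have := @cvg_Rintegral_sets R g (fun n => `]-oo, n.+1%:R]%classic) setT Ig.
rewrite (_ : \int[lm]_(x in setT) g x = mean V f) // f0; apply => //.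
move=> x; near=> n; rewrite in_setT mem_set //= in_itv /=.
apply: (@le_trans _ _ n%:R); last by rewrite ler_nat.
near: n; exact: nbhs_infty_ger.
Unshelve. all: by end_near. Qed.

Let Phi_ninfty : Phi (- n.+1%:R) @[n --> \oo] --> 0.
Proof.
have := @cvg_Rintegral_sets R g (fun n => `]-oo, - n.+1%:R]%classic) set0 Ig.
rewrite Rintegral_set0; apply => //.
move=> x; near=> n; rewrite in_set0 memNset //= in_itv /= => H.
suff : - n.+1%:R < x by rewrite ltNge H.
rewrite ltrNl; apply: (@le_lt_trans _ _ n%:R); last by rewrite ltr_nat.
near: n; exact: nbhs_infty_ger.
Unshelve. all: by end_near. Qed.

Let B0 : 0 <= B. Proof. exact: le_trans (fB 0). Qed.

Let dens_cvg0 (u : nat -> R) : (forall n, n.+1%:R <= `|u n|) -> dens V (u n) @[n --> \oo] --> 0.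
Proof.
move=> Hu; have := polygrowth_cvg0 sV r0 HV (polygrowth_cst 1) Hu.
by apply: cvg_trans; apply: near_eq_cvg; near=> n; rewrite mul1r.
Unshelve. all: by end_near. Qed.

(* For [x0 <= t] one has [V' x0 <= V' t], so the barrier [B / V' x0 * dens] decreases faster
   than [- sg * Phi] increases, and both vanish at infinity; symmetrically to the left. *)
Let Phi_barrier (sg x0 : R) : `|sg| = 1 -> 0 <= B * dens V x0 + sg * `|V' x0| * Phi x0.
Proof.
move=> sg1; set a := `|V' x0|.
have a0 : 0 <= a by exact: normr_ge0.
(* The barrier is multiplied through by [|V' x0|], which may be zero; this coefficient stays frozen
   at [x0] while [t] varies. *)
pose s t := B * dens V t + sg * a * Phi t.
have ds : has_derivative s (fun t => (- B * V' t + sg * a * f t) * dens V t).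
  have := has_derivativeD (has_derivativeZ B (has_derivative_dens sV))
    (has_derivativeZ (sg * a) dPhi).
  by move/has_derivative_eq; apply => t; rewrite /g; ring.
have sf t : `|sg * a * f t| <= a * B.
  by rewrite 2!normrM sg1 mul1r (ger0_norm a0) ler_wpM2l.
have lim (u : nat -> R) : (forall n, n.+1%:R <= `|u n|) -> Phi (u n) @[n --> \oo] --> 0 ->
    s (u n) @[n --> \oo] --> 0.
  move=> Hu HP; have := cvgD (cvgM (cvg_cst B) (dens_cvg0 Hu)) (cvgM (cvg_cst (sg * a)) HP).
  by rewrite !mulr0 addr0; apply.
rewrite -/(s x0).
have [V0|V0] := leP 0 (V' x0).
- have H : s n.+1%:R @[n --> \oo] --> 0.
    by apply: (lim (fun n => n.+1%:R)) => // n; rewrite ler_norm.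
  apply: (ler_cvg_to H (cvg_cst (s x0))); near=> n.
  have xn : x0 <= n.+1%:R.
    apply: (@le_trans _ _ n%:R); last by rewrite ler_nat.
    near: n; exact: nbhs_infty_ger.
  have [c /andP[xc cn] E] := has_derivative_mean_value ds xn.
  rewrite -subr_le0 E; apply: mulr_le0_ge0; last by lra.
  apply: mulr_le0_ge0; last exact: dens_ge0.
  have := sf c; rewrite ler_norml => /andP[_ H2].
  have := V'_growth sV HV xc => H3.
  have aE : a = V' x0 by rewrite /a ger0_norm.
  have H4 : 0 <= r * (c - x0) by rewrite mulr_ge0 ?(ltW r0) ?subr_ge0.
  have H5 : a <= V' c by lra.
  by have := ler_wpM2r B0 H5; lra.
- have H : s (- n.+1%:R) @[n --> \oo] --> 0.
    by apply: (lim (fun n => - n.+1%:R)) => // n; rewrite normrN ler_norm.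
  apply: (ler_cvg_to H (cvg_cst (s x0))); near=> n.
  have xn : - n.+1%:R <= x0.
    rewrite lerNl; apply: (@le_trans _ _ n%:R); last by rewrite ler_nat.
    near: n; exact: nbhs_infty_ger.
  have [c /andP[nc cx] E] := has_derivative_mean_value ds xn.
  rewrite -subr_ge0 E; apply: mulr_ge0; last by lra.
  apply: mulr_ge0; last exact: dens_ge0.
  have := sf c; rewrite ler_norml => /andP[H2 _].
  have := V'_growth sV HV cx => H3.
  have aE : a = - V' x0 by rewrite /a ltr0_norm.
  have H4 : 0 <= r * (x0 - c) by rewrite mulr_ge0 ?(ltW r0) ?subr_ge0.
  have H5 : a <= - V' c by lra.
  by have := ler_wpM2r B0 H5; lra.
Unshelve. all: by end_near. Qed.

(** The barrier for both signs gives [|V'| |Phi| <= B dens], which is the bound on [V' v]. Then [v]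
    is bounded by [B] where [|V'| >= 1], and by continuity on the remaining compact set. *)
Lemma adjoint_derivative_surjective : exists v : R -> R,
  [/\ has_derivative v (fun x => V' x * v x - f x),
      (forall x, `|V' x * v x| <= B) &
      exists C : R, forall x, `|v x| <= C].
Proof.
have Z0 := Zc_gt0 sV r0 HV.
(* The second factor is [1 / dens]. *)
pose v x := - Phi x * (Zc V * expR (V x)).
have dE x : dens V x * (Zc V * expR (V x)) = 1.
  by rewrite /dens expRN; field; rewrite !gt_eqF ?expR_gt0.
have dv : has_derivative v (fun x => V' x * v x - f x).
  have := has_derivativeM (has_derivativeZ (-1) dPhi)
    (has_derivativeZ (Zc V) (has_derivative_expR dV)).
  rewrite (_ : (fun x => _ * _) = v); last by apply/funext => x; rewrite mulN1r.
  move/has_derivative_eq; apply => x; rewrite /v /g.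
  rewrite [X in _ = _ - X](_ : _ = f x * (dens V x * (Zc V * expR (V x)))); first by ring.
  by rewrite dE mulr1.
have vB x : `|V' x * v x| <= B.
  have d0 : 0 < dens V x by rewrite divr_gt0 ?expR_gt0.
  have H1 := Phi_barrier x (normr1 R); have H2 := Phi_barrier x (normrN1 R).
  have vd : v x * dens V x = - Phi x.
    by rewrite /v -mulrA [_ * dens V x]mulrC dE mulr1.
  rewrite -(ler_pM2r d0).
  have -> : `|V' x * v x| * dens V x = `|V' x| * `|Phi x|.
    transitivity `|V' x * v x * dens V x|; first by rewrite [RHS]normrM (gtr0_norm d0).
    by rewrite -mulrA vd normrM normrN.
  by have [p|p] := leP 0 (Phi x); [rewrite ger0_norm|rewrite ltr0_norm]; lra.
exists v; split => //.
have [M HM] := normr_V'_ge1.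
have [C C0 HC] := continuous_bounded_itv M (has_derivative_continuous dv).
exists (B + C) => x; have [xM|xM] := leP `|x| M.
  by apply: le_trans (HC _ xM) _; rewrite lerDr.
apply: (@le_trans _ _ B); last by rewrite lerDl.
by apply: le_trans (vB x); rewrite (normrM (V' x)) ler_peMl // HM.
Qed.

End Resolvent.

(** * The spectral gap inequality with moment errors *)

(** The class in which the induction runs: it contains the test functions, and the solution of
    [A* v = f - m] for tame [f] is again tame, since [v' = V' v - (f - m)] is bounded. *)
Definition tame (f df : R -> R) : Prop :=
  [/\ has_derivative f df, continuous df & exists B : R, forall x, `|f x| <= B /\ `|df x| <= B].

Local Notation moment f i := (mean V (fun x => f x * x ^+ i)).

(** Raises the constant from [c] to [c + r]. Let [f0 = f - m = A* v], [a = |f0|^2], [q = |v|^2],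
    [E = |f'|^2]. The hypothesis on [v] and the commutation bound give [(c + r) q <= a + d] with a
    moment error [d], and Cauchy-Schwarz gives [a^2 <= E q]. The new error constant adds the cost of
    centring [f] to that of the moments of [v]. *)
Lemma approx_spectral_gap_step (c C : R) (n : nat) (f df : R -> R) :
  0 <= c -> 0 <= C ->
  (forall v dv, tame v dv ->
    c * (mean V (fun x => v x ^+ 2) - C * \sum_(i < n) moment v i ^+ 2)
      <= mean V (fun x => dv x ^+ 2)) ->
  tame f df ->
  (c + r) * (mean V (fun x => f x ^+ 2) -
    ((mean V (fun=> 1))^-1 + c * C * \sum_(i < n)
       (2 + 2 * (mean V (fun x => x ^+ i.+1) / mean V (fun=> 1)) ^+ 2))
      * \sum_(i < n.+1) moment f i ^+ 2)
    <= mean V (fun x => df x ^+ 2).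
Proof.
move=> c0 C0 IH [Df cdf [B HB]].
have cf := has_derivative_continuous Df.
have pf : polygrowth f by apply: (polygrowth_bounded cf (C := B)) => x; case: (HB x).
have pdf : polygrowth df by apply: (polygrowth_bounded cdf (C := B)) => x; case: (HB x).
have p1 := @polygrowth_cst R 1.
have pX i : polygrowth (fun x : R => x ^+ i) := polygrowthX i (@polygrowth_id R).
(* The total mass is carried along as a positive constant and never evaluated. *)
set M0 := mean V (fun=> 1).
have M00 : 0 < M0.
  apply: (@mean_gt0 R V cV (fun=> 1) 0) => //; [exact: pInt|by move=> x; exact: cvg_cst|].
  exact: Zc_gt0 sV r0 HV.
pose m := mean V f / M0.
pose f0 x := f x + (- m) * 1.
have cf0 : continuous f0 by move=> x; apply: cvgD; [exact: cf|exact: cvg_cst].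
have f0B x : `|f0 x| <= B + `|m|.
  by apply: le_trans (ler_normD _ _) _; rewrite mulr1 normrN lerD2r; case: (HB x).
have pf0 : polygrowth f0 := polygrowth_bounded cf0 f0B.
have mf0 : mean V f0 = 0.
  rewrite /f0 meanD //; [|exact: pInt|exact/pInt/polygrowthZ].
  by rewrite meanZ; [rewrite -/M0 /m; field; rewrite gt_eqF|exact: pInt].
have [v [Dv Vv [K HK]]] := adjoint_derivative_surjective cf0 f0B mf0.
set dv := (fun x => V' x * v x - f0 x) in Dv.
have cv := has_derivative_continuous Dv.
have pv : polygrowth v := polygrowth_bounded cv HK.
have cVv : continuous (fun x => V' x * v x).
  by move=> x; apply: cvgM; [exact: V'_continuous sV x|exact: cv].
have pVv : polygrowth (fun x => V' x * v x) := polygrowth_bounded cVv Vv.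
have dvE : dv = (fun x => V' x * v x + -1 * f0 x) by apply/funext => x; rewrite mulN1r.
have pdv : polygrowth dv by rewrite dvE; apply: polygrowthD => //; exact: polygrowthZ.
have cdv : continuous dv by case: pdv.
have dvB x : `|dv x| <= (B + `|m|) + (B + `|m|).
  by apply: le_trans (ler_normB _ _) _; apply: lerD.
have tv : tame v dv.
  split => //; exists (K + (B + `|m|) + (B + `|m|)) => x.
  have := HK x; have := dvB x; have := f0B x.
  have := normr_ge0 (v x); have := normr_ge0 (dv x); have := normr_ge0 (f0 x).
  by split; lra.
have := IH _ _ tv; set q := mean V (fun x => v x ^+ 2); set Ev := mean V (fun x => dv x ^+ 2).
set a := mean V (fun x => f0 x ^+ 2); set E := mean V (fun x => df x ^+ 2).
have E0 : 0 <= E by apply: mean_ge0 => x; rewrite sqr_ge0.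
have a0 : 0 <= a by apply: mean_ge0 => x; rewrite sqr_ge0.
have Df0 : has_derivative f0 df.
  have := has_derivativeD Df (has_derivative_cst (- m * 1)).
  by move/has_derivative_eq; apply => x; rewrite addr0.
have f0E x : f0 x = V' x * v x - dv x by rewrite /dv; ring.
have pA : polygrowth (fun x => V' x * v x - dv x).
  by rewrite (_ : (fun x => _) = f0) //; apply/funext => x; rewrite f0E.
have H2 : Ev + r * q <= a.
  have := mean_adjoint_sqr_ge Dv cdv pv pdv pVv.
  by congr (_ <= mean V _); apply/funext => x; rewrite f0E.
(* By parts against [x^(i+1)], moment [i] of [v] becomes moment [i + 1] of [f0]; hence [n] moments
   of [v] are controlled by [n + 1] moments of [f]. *)
have H3 i : i.+1%:R * moment v i = moment f i.+1 - m * mean V (fun x => x ^+ i.+1).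
  have -> : moment f i.+1 - m * mean V (fun x => x ^+ i.+1) = moment f0 i.+1.
    rewrite -mulNr -meanZ; last exact: pInt.
    rewrite -meanD; [|exact/pInt/polygrowthM|exact/pInt/polygrowthZ].
    by congr (mean V _); apply/funext => x; rewrite /f0; ring.
  have DX : has_derivative (fun x : R => x ^+ i.+1) (fun x => i.+1%:R * x ^+ i).
    have := has_derivativeX i (@has_derivative_id R).
    by move/has_derivative_eq; apply => x; rewrite mulr1.
  have := mean_adjoint_mul DX Dv cdv (pX _) (polygrowthZ _ (pX i)) pv pA.
  under [in LHS]eq_fun do rewrite -f0E.
  move=> ->; rewrite -meanZ; last exact/pInt/polygrowthM.
  by congr (mean V _); apply/funext => x; ring.
(* [|f0|^2 = <A* v, f0> = <v, f'>], as [f0] and [f] have the same derivative. *)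
have H4 : a = ip V df v.
  have := mean_adjoint_mul Df0 Dv cdv pf0 pdf pv pA.
  under [in LHS]eq_fun do rewrite -f0E.
  rewrite /a (_ : (fun x => f0 x ^+ 2) = (fun x => f0 x * f0 x)); last first.
    by apply/funext => x; rewrite expr2.
  by move=> ->; rewrite /ip /mean; congr (fine (muint V _)); apply/funext => x; rewrite mulrC.
have CS : a ^+ 2 <= E * q.
  rewrite H4; apply: le_trans (ip_CauchySchwarz cV (pL2 pdf) (pL2 pv)) _.
  rewrite /ip -!/(mean V _) le_eqVlt; apply/orP; left; apply/eqP.
  by congr (mean V _ * mean V _); apply/funext => x; rewrite expr2.
set S := \sum_(i < n.+1) _; set Kn := \sum_(i < n) (2 + _).
have S0 : 0 <= S by apply: sumr_ge0 => i _; exact: sqr_ge0.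
have Sge i : (i < n.+1)%N -> moment f i ^+ 2 <= S.
  move=> Hi; rewrite /S (bigD1 (Ordinal Hi)) //= lerDl.
  by apply: sumr_ge0 => j _; exact: sqr_ge0.
(* [m^2 M0] is the squared norm of the constant removed from [f], and equals [<f, 1>^2 / M0]. *)
have m2 : m ^+ 2 * M0 <= M0^-1 * S.
  have -> : m ^+ 2 * M0 = M0^-1 * moment f 0 ^+ 2.
    have -> : moment f 0 = mean V f by congr (mean V _); apply/funext => x; rewrite expr0 mulr1.
    by rewrite /m; field; rewrite gt_eqF.
  by rewrite ler_wpM2l ?invr_ge0 ?(ltW M00) // Sge.
have aE : a = mean V (fun x => f x ^+ 2) - m ^+ 2 * M0.
  have -> : a = mean V (fun x => f x ^+ 2 + (-2 * m * f x + m ^+ 2 * 1)).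
    by congr (mean V _); apply/funext => x; rewrite /f0; ring.
  have I1 := pInt pf; have I2 := pInt p1; have I3 := pInt (polygrowthX 2 pf).
  rewrite meanD //; last by apply: mu_integrableD; exact: mu_integrableZ.
  rewrite meanD; [|exact: mu_integrableZ..].
  rewrite !meanZ // -/M0 (_ : mean V f = m * M0); last by rewrite /m; field; rewrite gt_eqF.
  ring.
(* The weight [2 + 2 (Mi / M0)^2] comes from [(y - z)^2 <= 2 y^2 + 2 z^2] with [y] a moment of [f]
   and [z = m Mi]; the factor [(i + 1)^2 >= 1] is dropped. *)
have SK : \sum_(i < n) moment v i ^+ 2 <= Kn * S.
  rewrite mulr_suml; apply: ler_sum => i _.
  set Mi := mean V (fun x => x ^+ i.+1).
  have H5 : moment v i ^+ 2 <= (moment f i.+1 - m * Mi) ^+ 2.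
    rewrite -H3 exprMn ler_peMl ?sqr_ge0 // exprn_ege1 // ler1n //.
  apply: le_trans H5 _.
  have H6 := Sge i.+1 (ltn_ord i).
  have H7 : m ^+ 2 * M0 * (Mi ^+ 2 / M0) <= M0^-1 * S * (Mi ^+ 2 / M0).
    by rewrite ler_wpM2r // divr_ge0 ?sqr_ge0 // ltW.
  have E7 : m ^+ 2 * M0 * (Mi ^+ 2 / M0) = (m * Mi) ^+ 2 by field; rewrite gt_eqF.
  have E8 : M0^-1 * S * (Mi ^+ 2 / M0) = (Mi / M0) ^+ 2 * S by field; rewrite gt_eqF.
  rewrite E7 E8 in H7.
  rewrite mulrDl -[2 * _ * S]mulrA.
  move: (moment f i.+1) (m * Mi) ((Mi / M0) ^+ 2 * S) H6 H7 => y z t H6 H7.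
  by have := sqr_ge0 (y + z); rewrite sqrrD sqrrB; lra.
move=> H1.
have Kn0 : 0 <= Kn.
  by apply: sumr_ge0 => i _; rewrite addr_ge0 // mulr_ge0 // sqr_ge0.
pose d := c * C * Kn * S.
have d0 : 0 <= d by rewrite !mulr_ge0.
have Hq : (c + r) * q <= a + d.
  have : c * (C * \sum_(i < n) moment v i ^+ 2) <= d.
    by rewrite /d -!mulrA ler_wpM2l // ler_wpM2l.
  by move: H1 H2; rewrite mulrBr mulrDl; lra.
(* [(c + r) a^2 <= E (a + d)], and [a^2 >= (a - d) (a + d)]. *)
have Hfin : (c + r) * (a - d) <= E.
  have [ad|ad] := leP (a + d) 0.
    have a00 : a <= 0 by apply: le_trans ad; rewrite lerDl.
    apply: le_trans E0; rewrite mulr_ge0_le0 ?addr_ge0 ?(ltW r0) // subr_le0.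
    exact: le_trans d0.
  rewrite -(ler_pM2r ad).
  apply: (@le_trans _ _ ((c + r) * a ^+ 2)).
    rewrite -mulrA ler_wpM2l ?addr_ge0 ?(ltW r0) //.
    by have := sqr_ge0 d; rewrite -subr_sqr; lra.
  apply: (@le_trans _ _ ((c + r) * (E * q))).
    by rewrite ler_wpM2l // addr_ge0 // ltW.
  by rewrite mulrCA ler_wpM2l.
apply: le_trans Hfin; rewrite ler_wpM2l ?addr_ge0 ?(ltW r0) // aE mulrDl /d; lra.
Qed.

(** [C] is chosen before [f]: this uniformity lets the moment errors vanish along an approximating
    sequence. *)
Theorem approx_spectral_gap n : exists2 C : R, 0 <= C & forall f df, tame f df ->
  n%:R * r * (mean V (fun x => f x ^+ 2) - C * \sum_(i < n) moment f i ^+ 2)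
    <= mean V (fun x => df x ^+ 2).
Proof.
elim: n => [|n [C C0 IH]].
  exists 0 => // f df _; rewrite !mul0r; apply: mean_ge0 => x; exact: sqr_ge0.
have nr0 : 0 <= n%:R * r by rewrite mulr_ge0 // ltW.
exists ((mean V (fun=> 1))^-1 + n%:R * r * C * \sum_(i < n)
    (2 + 2 * (mean V (fun x => x ^+ i.+1) / mean V (fun=> 1)) ^+ 2)); last first.
  move=> f df tf; have := approx_spectral_gap_step nr0 C0 IH tf.
  by have -> : n.+1%:R * r = n%:R * r + r by rewrite -natr1 mulrDl mul1r.
rewrite addr_ge0 // ?invr_ge0; first by apply: mean_ge0.
rewrite mulr_ge0 //; first by rewrite mulr_ge0.
by apply: sumr_ge0 => i _; rewrite addr_ge0 // mulr_ge0 // sqr_ge0.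
Qed.

(** * Test functions and passage to the closure of L *)

Lemma compact_support_bounded (h : R -> R) (M : R) : continuous h ->
  (forall x, M < `|x| -> h x = 0) -> exists B : R, forall x, `|h x| <= B.
Proof.
move=> ch h0; have [B B0 HB] := continuous_bounded_itv M ch; exists B => x.
by have [/HB //|/h0 ->] := leP `|x| M; rewrite normr0.
Qed.

Lemma smooth_derive1 (f : R -> R) : smooth f -> smooth (derive1 f).
Proof. by move=> sf n x; have := @sf n.+1 x; rewrite /derive1n iterSr. Qed.

(** The region [M < |x|] is open, so [f] vanishes near each of its points. *)
Lemma derive1_compact_support (f : R -> R) (M : R) :
  (forall x, M < `|x| -> f x = 0) -> forall x, M < `|x| -> derive1 f x = 0.
Proof.
move=> f0 x Mx; rewrite derive1E -(derive_cst (0 : R) x (1 : R)).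
apply: near_eq_derive; near=> y; apply: f0; near: y.
have H : `|z| @[z --> x] --> `|x| by apply: cvg_norm; exact: cvg_id.
exact: (cvgr_gt _ H _ Mx).
Unshelve. all: by end_near. Qed.

Lemma test_fun_tame (phi : R -> R) : test_fun phi -> tame phi (derive1 phi).
Proof.
move=> [sphi [M HM]].
have D1 := smooth_has_derivative1 sphi.
have D2 := smooth_has_derivative1 (smooth_derive1 sphi).
have c1 := has_derivative_continuous D1; have c2 := has_derivative_continuous D2.
have [B HB] := compact_support_bounded c1 HM.
have [B' HB'] := compact_support_bounded c2 (derive1_compact_support HM).
split => //; exists (`|B| + `|B'|) => x; split.
  apply: le_trans (HB x) _; apply: le_trans (ler_norm B) _; by rewrite lerDl.
apply: le_trans (HB' x) _; apply: le_trans (ler_norm B') _; by rewrite lerDr.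
Qed.

(** [L phi = - A* phi'], so the energy identity is adjointness with [u = phi] and [v = phi'].
    However fast [V'] grows, [A* phi'] is continuous with compact support, hence bounded. *)
Lemma test_fun_Lop (phi : R -> R) : test_fun phi ->
  [/\ L2 V phi, L2 V (Lop V phi) &
      mean V (fun x => derive1 phi x ^+ 2) = - ip V phi (Lop V phi)].
Proof.
move=> tphi; have [D1 c1' [B HB]] := test_fun_tame tphi.
case: tphi => sphi [M HM].
have D2 := smooth_has_derivative1 (smooth_derive1 sphi).
have D3 := smooth_has_derivative1 (smooth_derive1 (smooth_derive1 sphi)).
have c1 := has_derivative_continuous D1; have c2 := has_derivative_continuous D3.
have M1 := derive1_compact_support HM; have M2 := derive1_compact_support M1.
have p0 : polygrowth phi by apply: (polygrowth_bounded c1 (C := B)) => x; case: (HB x).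
have p1 : polygrowth (derive1 phi).
  by apply: (polygrowth_bounded c1' (C := B)) => x; case: (HB x).
have pA : polygrowth (fun x => V' x * derive1 phi x - derive1 (derive1 phi) x).
  have cA : continuous (fun x => V' x * derive1 phi x - derive1 (derive1 phi) x).
    rewrite (_ : (fun x => _) =
      (fun x => V' x * derive1 phi x + -1 * derive1 (derive1 phi) x)).
      apply: continuous_add; apply: continuous_mul => //; first exact: V'_continuous sV.
      by move=> x; exact: cvg_cst.
    by apply/funext => x; rewrite mulN1r.
  have [|B1 HB1] := compact_support_bounded (M := M) cA.
    by move=> x Mx; rewrite M1 // M2 // mulr0 subr0.
  exact: polygrowth_bounded cA HB1.
have LE : Lop V phi = (fun x => -1 * (V' x * derive1 phi x - derive1 (derive1 phi) x)).
  by apply/funext => x; rewrite /Lop /derive1n /=; ring.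
have pL : polygrowth (Lop V phi) by rewrite LE; exact: polygrowthZ.
split; [exact: pL2|exact: pL2|].
rewrite (_ : (fun x => _ ^+ 2) = (fun x => derive1 phi x * derive1 phi x)); last first.
  by apply/funext => x; rewrite expr2.
rewrite -(mean_adjoint_mul D1 D2 c2 p0 p1 p1 pA) LE ipC.
by rewrite (ipZl cV _ (pL2 pA) (pL2 p0)) mulN1r opprK.
Qed.

(** The approximating test functions need not be orthogonal to the monomials, but their moments tend
    to 0 by continuity of the inner product; the inequality with uniform [C] then passes to the
    limit. *)
Theorem graphL_spectral_gap (n : nat) (f Lf : R -> R) : graphL V f Lf ->
  (forall i, (i < n)%N -> ip V f (fun x => x ^+ i) = 0) ->
  n%:R * r * ip V f f <= - ip V f Lf.
Proof.
move=> [Lf2 [LLf2 [phi [tphi [cphi cL]]]]] Hort.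
have [C C0 HC] := approx_spectral_gap n.
have Lphi k := let: And3 a _ _ := test_fun_Lop (tphi k) in a.
have LLphi k := let: And3 _ b _ := test_fun_Lop (tphi k) in b.
have pX i : L2 V (fun x : R => x ^+ i) by apply/pL2/polygrowthX/polygrowth_id.
have c1 := ip_cvg cV Lphi Lphi Lf2 Lf2 cphi cphi.
have c2 := ip_cvg cV Lphi LLphi Lf2 LLf2 cphi cL.
have c3 (i : 'I_n) : ip V (phi k) (fun x => x ^+ i) @[k --> \oo] --> 0.
  rewrite -(Hort i) //; apply: ip_cvg => //; apply: cvg_near_cst; near=> k.
  have -> : (fun x : R => (x ^+ i - x ^+ i) ^+ 2) = (fun=> 0).
    by apply/funext => x; rewrite subrr expr0n.
  by rewrite /muint; under eq_integral do rewrite mul0r; rewrite integral0.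
have c4 : n%:R * r * (ip V (phi k) (phi k) -
    C * \sum_(i < n) ip V (phi k) (fun x => x ^+ i) ^+ 2) @[k --> \oo] -->
    n%:R * r * (ip V f f - C * \sum_(i < n) 0 ^+ 2).
  apply: cvgM; first exact: cvg_cst.
  apply: cvgB => //; apply: cvgM; first exact: cvg_cst.
  apply: cvg_big => [|i _]; first exact: add_continuous.
  rewrite expr2 (_ : (fun k => _) = (fun k => ip V (phi k) (fun x => x ^+ i) *
      ip V (phi k) (fun x => x ^+ i))); first exact: cvgM.
  by apply/funext => k; rewrite expr2.
have -> : n%:R * r * ip V f f = n%:R * r * (ip V f f - C * \sum_(i < n) 0 ^+ 2).
  by rewrite big1 ?mulr0 ?subr0 // => i _; rewrite expr0n.
apply: (ler_cvg_to c4 (cvgN c2)); near=> k.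
rewrite [leRHS](_ : _ = - ip V (phi k) (Lop V (phi k))) //.
have [_ _ <-] := test_fun_Lop (tphi k).
apply: le_trans (HC _ _ (test_fun_tame (tphi k))).
rewrite le_eqVlt; apply/orP; left; apply/eqP.
congr (_ * (mean V _ - _)); apply/funext => x; by rewrite expr2.
Unshelve. all: by end_near. Qed.

End LowerBound.

(** * Smoothness and a compactly supported bump function *)

Section Smoothness.
Variable R : realType.
Implicit Types f g df dg : R -> R.

(** Provides [n + 1] derivatives, taking the first derivative of [f] before recursing; this form
    suits inductions over products and compositions. *)
Fixpoint ndiff (n : nat) (f : R -> R) : Prop :=
  if n is m.+1 then exists2 df, has_derivative f df & ndiff m df
  else exists df, has_derivative f df.

Lemma has_derivative_derive1 f df : has_derivative f df -> derive1 f = df.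
Proof.
by move=> H; apply/funext => x; rewrite derive1E (@derive_val _ _ _ _ _ _ _ (H x)).
Qed.

Lemma smooth_ndiff f : (forall n, ndiff n f) -> smooth f.
Proof.
move=> H n x; move: (H n); elim: n f x {H} => [|n IH] f x /=.
  by move=> [df Df]; exact: (@ex_derive _ _ _ _ _ _ _ (Df x)).
by move=> [df Df /IH]; rewrite -(has_derivative_derive1 Df) -iterS iterSr; apply.
Qed.

Lemma ndiff_smooth f n : smooth f -> ndiff n f.
Proof.
elim: n f => [|n IH] f sf /=; exists (derive1 f); try exact: smooth_has_derivative1.
exact/IH/smooth_derive1.
Qed.

Lemma ndiffS n f : ndiff n.+1 f -> ndiff n f.
Proof.
elim: n f => [|n IH] f /= [df Df H]; first by exists df.
by exists df => //; apply: IH.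
Qed.

Lemma ndiffD n f g : ndiff n f -> ndiff n g -> ndiff n (fun x => f x + g x).
Proof.
elim: n f g => [|n IH] f g /=.
  by move=> [df Df] [dg Dg]; exists (fun x => df x + dg x); exact: has_derivativeD.
move=> [df Df nf] [dg Dg ng]; exists (fun x => df x + dg x).
  exact: has_derivativeD.
exact: IH.
Qed.

(** Leibniz rule: the products [df * g] and [f * dg] need [f] and [g] only at the lower order,
    whence [ndiffS]. *)
Lemma ndiffM n f g : ndiff n f -> ndiff n g -> ndiff n (fun x => f x * g x).
Proof.
elim: n f g => [|n IH] f g.
  move=> [df Df] [dg Dg]; exists (fun x => df x * g x + f x * dg x).
  exact: has_derivativeM.
move=> nf ng; have nf' := ndiffS nf; have ng' := ndiffS ng.
move: nf ng => [df Df nf] [dg Dg ng].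
exists (fun x => df x * g x + f x * dg x); first exact: has_derivativeM.
by apply: ndiffD; exact: IH.
Qed.

Lemma smoothM f g : smooth f -> smooth g -> smooth (fun x => f x * g x).
Proof. by move=> sf sg; apply: smooth_ndiff => n; apply: ndiffM; exact: ndiff_smooth. Qed.

Lemma has_derivative_affine a b f df : has_derivative f df ->
  has_derivative (fun x => f (a * x + b)) (fun x => a * df (a * x + b)).
Proof.
move=> H x.
have D := has_derivativeD (has_derivativeZ a (@has_derivative_id R)) (has_derivative_cst b).
have := @is_derive1_comp R f (fun y => a * y + b) x _ _ (H (a * x + b)) (D x).
by rewrite mulr1 addr0 mulrC; apply.
Qed.

Lemma ndiff_cst n (c : R) : ndiff n (fun=> c).
Proof.
elim: n c => [|n IH] c /=; exists (fun=> 0); try exact: has_derivative_cst.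
exact: IH.
Qed.

Lemma smooth_affine a b f : smooth f -> smooth (fun x => f (a * x + b)).
Proof.
move=> sf; apply: smooth_ndiff => n; have := ndiff_smooth n sf.
elim: n f {sf} => [|n IH] f /=.
  by move=> [df Df]; exists (fun x => a * df (a * x + b)); exact: has_derivative_affine.
move=> [df Df nf]; exists (fun x => a * df (a * x + b)).
  exact: has_derivative_affine.
by apply: ndiffM; [exact: ndiff_cst|exact: IH].
Qed.

Lemma smooth_horner (p : {poly R}) : smooth (horner p).
Proof.
apply: smooth_ndiff => n; elim: n p => [|n IH] p /=; exists (horner p^`());
  by [exact: is_derive_poly|exact: IH].
Qed.

(* The class of functions [flat p] is closed under differentiation, whence its smoothness. *)
Definition flat (p : {poly R}) (t : R) : R := if 0 < t then p.[t^-1] * expR (- t^-1) else 0.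

Lemma pow_expRN_le k (s : R) : 0 <= s -> s ^+ k * expR (- s) <= k`!%:R.
Proof.
move=> s0; rewrite expRN ler_pdivrMr ?expR_gt0 //.
case: k => [|k]; first by rewrite expr0 fact0 mul1r -{1}(expR0 R) ler_expR.
have F : 0 < (k.+1)`!%:R :> R by rewrite ltr0n fact_gt0.
rewrite mulrC -ler_pdivrMr //; apply: le_trans (expR_ge1Dxn k s0).
by rewrite lerDr.
Qed.

Lemma poly_expRN_bounded (p : {poly R}) :
  exists2 C : R, 0 <= C & forall s : R, 0 <= s -> `|p.[s]| * expR (- s) <= C.
Proof.
exists (\sum_(i < size p) `|p`_i| * i`!%:R).
  by apply: sumr_ge0 => i _; rewrite mulr_ge0.
move=> s s0; rewrite horner_coef.
apply: (@le_trans _ _ ((\sum_(i < size p) `|p`_i * s ^+ i|) * expR (- s))).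
  by rewrite ler_wpM2r ?expR_ge0 // ler_norm_sum.
rewrite mulr_suml; apply: ler_sum => i _.
rewrite normrM (ger0_norm (exprn_ge0 i s0)) -mulrA ler_wpM2l //.
exact: pow_expRN_le.
Qed.

(** The polynomial bound applied to [X^2 p] at [1 / t] yields the factor [t^2]; this makes [flat p]
    differentiable at 0 with derivative 0. *)
Lemma flat_le_sqr p : exists2 C : R, 0 <= C & forall t, `|flat p t| <= C * t ^+ 2.
Proof.
have [C C0 HC] := poly_expRN_bounded ('X^2 * p); exists C => // t.
rewrite /flat; case: ifPn => [t0|_]; last by rewrite normr0 mulr_ge0 ?sqr_ge0.
have ti : 0 <= t^-1 by rewrite invr_ge0 ltW.
have := HC _ ti; rewrite hornerM hornerXn normrM (ger0_norm (exprn_ge0 2 ti)).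
rewrite normrM (ger0_norm (expR_ge0 _)) -ler_pdivrMr ?exprn_gt0 // -exprVn.
by rewrite [X in _ -> X <= _]mulrC mulrA.
Qed.

(** For [t > 0] the derivative of [p(1/t) e^(-1/t)] is [t^(-2) (p - p')(1/t) e^(-1/t)]. For [t < 0]
    the function is locally zero, and at 0 the difference quotient is at most [C |h|]. *)
Lemma is_derive_flat p t :
  is_derive t (1 : R) (flat p) (flat ('X^2 * (p - p^`())) t).
Proof.
have [t0|t0|->] := ltgtP t 0.
- rewrite {2}/flat ltNge (ltW t0) /=.
  have N : {near t, cst 0 =1 flat p}.
    near=> u; rewrite /flat ifF //; apply/negbTE; rewrite -leNgt ltW //.
    by near: u; exact: lt_nbhsl.
  exact: (near_eq_is_derive N (is_derive_cst _ _ _)).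
- have tn : t != 0 by rewrite gt_eqF.
  pose h u := p.[u^-1] * expR (- u^-1).
  have Dh : is_derive t (1 : R) h (flat ('X^2 * (p - p^`())) t).
    have Di : is_derive t (1 : R) (fun u => u^-1) (- t ^- 2).
      by have := @is_deriveV R id t 1 1 tn (is_derive_id _ _); rewrite /GRing.scale /= mulr1.
    have D1 := @is_derive1_comp R (horner p) (fun u => u^-1) t _ _ (is_derive_poly _ _) Di.
    have Dm : is_derive t (1 : R) (fun u => - u^-1) (t ^- 2).
      by have := is_deriveN Di; rewrite opprK.
    have D2 := @is_derive1_comp R expR (fun u => - u^-1) t _ _ (is_derive_expR _) Dm.
    have := is_deriveM D1 D2; rewrite /GRing.scale /= => D3.
    apply: is_derive_eq D3 _.
    by rewrite /flat t0 hornerM hornerXn hornerD hornerN exprVn; ring.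
  have N : {near t, h =1 flat p}.
    near=> u; rewrite /flat ifT //.
    by near: u; exact: lt_nbhsr.
  exact: (near_eq_is_derive N Dh).
- have -> : flat ('X^2 * (p - p^`())) 0 = 0 by rewrite /flat ltxx.
  have [C C0 HC] := flat_le_sqr p.
  have f0 : flat p 0 = 0 by rewrite /flat ltxx.
  have H : (fun h : R => h^-1 *: ((flat p \o shift 0) (h *: (1 : R)) - flat p 0)) @ 0^' --> (0 : R).
    apply/norm_cvg0P.
    apply: (squeeze_cvgr (f := fun=> 0) (h := fun h => C * `|h|)).
    + near=> h; rewrite normr_ge0 /= addr0 /GRing.scale /= mulr1 f0 subr0.
      have hn : h != 0 by near: h; exact: nbhs_dnbhs_neq.
      rewrite normrM normfV ler_pdivrMl ?normr_gt0 //.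
      rewrite (_ : `|h| * (C * `|h|) = C * `|h| ^+ 2); last by ring.
      by rewrite real_normK ?num_real.
    + exact: cvg_cst.
    + rewrite -[X in _ --> X](mulr0 C); apply: cvgM; first exact: cvg_cst.
      have H0 : (fun h : R => `|h|) @ (0 : R)^' --> `|0 : R|.
        by apply: cvg_norm; exact: cvg_within.
      by rewrite normr0 in H0.
  apply: DeriveDef; last exact/cvg_lim.
  by apply/cvg_ex; exists 0.
Unshelve. all: by end_near. Qed.

Lemma smooth_flat p : smooth (flat p).
Proof.
apply: smooth_ndiff => n; elim: n p => [|n IH] p /=.
  by exists (flat ('X^2 * (p - p^`()))); move=> x; exact: is_derive_flat.
exists (flat ('X^2 * (p - p^`()))); last exact: IH.
by move=> x; exact: is_derive_flat.
Qed.

Lemma bump_exists : exists chi : R -> R,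
  [/\ smooth chi, chi 0 = 1 & forall x, 1 < `|x| -> chi x = 0].
Proof.
pose h := flat 1.
have h1 : h 1 != 0 by rewrite /h /flat ltr01 hornerE mul1r gt_eqF ?expR_gt0.
(* [h] is [e^(-1/t)] for [t > 0] and 0 otherwise, so the product of [h (1 + x)] and [h (1 - x)]
   vanishes for [|x| > 1]; the last factor normalizes the value at 0. *)
pose chi x := (h (1 * x + 1) * h (- 1 * x + 1)) * (h 1 ^- 2).
exists chi; split.
- apply: smooth_ndiff => n; apply: ndiffM; last exact: ndiff_cst.
  apply: ndiff_smooth; apply: smoothM; apply: smooth_affine; exact: smooth_flat.
- by rewrite /chi !mulr0 !add0r -expr2 mulfV // expf_neq0.
- move=> x; have [x0|x0] := leP 0 x => x1.
  + rewrite ger0_norm // in x1.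
    have -> : chi x = h (1 * x + 1) * 0 * (h 1 ^- 2).
      rewrite /chi; congr (_ * _ * _); rewrite /h /flat ifF //; apply/negbTE.
      by rewrite -leNgt; lra.
    by rewrite mulr0 mul0r.
  + rewrite ltr0_norm // in x1.
    have -> : chi x = 0 * h (- 1 * x + 1) * (h 1 ^- 2).
      rewrite /chi; congr (_ * _ * _); rewrite /h /flat ifF //; apply/negbTE.
      by rewrite -leNgt; lra.
    by rewrite mul0r mul0r.
Qed.

End Smoothness.

(** * Upper bound with polynomials as trial functions *)

Section UpperBound.
Variables (R : realType) (V : R -> R) (r K : R).
Hypothesis sV : smooth V.
Hypothesis r0 : 0 < r.
Hypothesis HV : forall x, r <= derive1n 2 V x.
Hypothesis HK : forall x, derive1n 2 V x <= K.
Notation V' := (derive1 V).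
Notation V'' := (derive1n 2 V).
Let cV : continuous V := V_continuous sV.
Let pInt := polygrowth_integrable sV r0 HV.
Let pL2 := polygrowth_L2 sV r0 HV.

Let K0 : 0 < K. Proof. exact: lt_le_trans r0 (le_trans (HV 0) (HK 0)). Qed.

Lemma polygrowth_le (f g : R -> R) : continuous f -> polygrowth g ->
  (forall x, `|f x| <= g x) -> polygrowth f.
Proof.
move=> cf [_ [C [k H]]] fg; split => //; exists C, k => x.
by apply: le_trans (fg x) _; apply: le_trans (ler_norm _) (H x).
Qed.

Lemma polygrowth_norm (f : R -> R) : polygrowth f -> polygrowth (fun x => `|f x|).
Proof.
move=> [cf [C [k H]]]; split; first by move=> x; apply: cvg_norm; exact: cf.
by exists C, k => x; rewrite normr_id.
Qed.

Lemma polygrowth_horner (p : {poly R}) : polygrowth (horner p).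
Proof.
elim/poly_ind: p => [|p c IH].
  by rewrite (_ : horner 0 = fun=> 0); [exact: polygrowth_cst|apply/funext => x; rewrite horner0].
rewrite (_ : horner _ = fun x => p.[x] * x + c); last first.
  by apply/funext => x; rewrite hornerMXaddC.
by apply: polygrowthD; [exact: (polygrowthM IH (@polygrowth_id R))|exact: polygrowth_cst].
Qed.

(** [0 < V'' <= K] makes [V'] Lipschitz, hence of linear growth; thus [A* p'] has polynomial growth
    for every polynomial [p]. *)
Lemma polygrowth_V' : polygrowth V'.
Proof.
apply: (@polygrowth_le _ (fun x => `|V' 0| + K * (1 + x ^+ 2))).
- exact: V'_continuous sV.
- apply: polygrowthD; first exact: polygrowth_cst.
  apply/polygrowthZ/polygrowthD; first exact: polygrowth_cst.
  exact/polygrowthX/polygrowth_id.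
move=> x; have -> : V' x = V' 0 + (V' x - V' 0) by ring.
apply: le_trans (ler_normD _ _) _; rewrite lerD2l.
have lip a b : a <= b -> `|V' b - V' a| <= K * `|b - a|.
  move=> ab; have [c _ ->] := has_derivative_mean_value (smooth_has_derivative2 sV) ab.
  rewrite normrM ler_wpM2r // ger0_norm //.
  exact: le_trans (ltW r0) (HV c).
apply: (@le_trans _ _ (K * `|x|)).
  have [x0|x0] := leP 0 x; first by have := lip _ _ x0; rewrite subr0.
  by have := lip _ _ (ltW x0); rewrite sub0r normrN distrC.
rewrite ler_pM2l //; rewrite -(real_normK (num_real x)).
by have := sqr_ge0 (`|x| - 1); have := normr_ge0 x; rewrite sqrrB expr1n mulr1; lra.
Qed.

Let dH (p : {poly R}) : has_derivative (horner p) (horner p^`()) := fun x => is_derive_poly p x.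
Let pH := polygrowth_horner.

Let pA (p : {poly R}) : polygrowth (fun x => V' x * p^`().[x] - p^`()^`().[x]).
Proof.
rewrite (_ : (fun x => _) = fun x => V' x * p^`().[x] + -1 * p^`()^`().[x]).
  by apply: polygrowthD; [exact: polygrowthM polygrowth_V' (pH _)|exact: polygrowthZ].
by apply/funext => x; rewrite mulN1r.
Qed.

Lemma mean_adjoint_horner (p : {poly R}) :
  mean V (fun x => p^`().[x] ^+ 2) =
  ip V (fun x => V' x * p^`().[x] - p^`()^`().[x]) (horner p).
Proof.
rewrite (_ : (fun x => _ ^+ 2) = (fun x => p^`().[x] * p^`().[x])); last first.
  by apply/funext => x; rewrite expr2.
by rewrite -(mean_adjoint_mul sV r0 HV (dH p) (dH _) (pH _).1 (pH p) (pH _) (pH _) (pA p)).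
Qed.

(** Induction on the degree, with the hypothesis applied to [p']: it bounds [|p''|^2], hence
    [|A* p'|^2 <= (n + 1) K |p'|^2]. Cauchy-Schwarz for [|p'|^2 = <A* p', p>] concludes after
    division by [|p'|^2], the case [p' = 0] in norm being trivial. *)
Lemma polynomial_energy_le (n : nat) (p : {poly R}) : (size p <= n.+1)%N ->
  mean V (fun x => p^`().[x] ^+ 2) <= n%:R * K * mean V (fun x => p.[x] ^+ 2).
Proof.
elim: n p => [|n IH] p sp.
  have -> : p^`() = 0 by rewrite (size1_polyC sp) derivC.
  rewrite !mul0r /mean /muint (_ : (\int[_]_x _ = 0)%E) //.
  by apply: integral0_eq => x _; rewrite horner0 expr0n mul0r.
set a := mean V (fun x => _ ^+ 2); set b := mean V (fun x => p.[x] ^+ 2).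
have a0 : 0 <= a by apply: mean_ge0 => x; exact: sqr_ge0.
have b0 : 0 <= b by apply: mean_ge0 => x; exact: sqr_ge0.
have sp' : (size p^`() <= n.+1)%N.
  have [->|p0] := eqVneq p 0; first by rewrite deriv0 size_poly0.
  by rewrite -ltnS; apply: leq_trans (lt_size_deriv p0) sp.
have CS := ip_CauchySchwarz cV (pL2 (pA p)) (pL2 (pH p)).
rewrite -mean_adjoint_horner -/a in CS.
have bE : ip V (horner p) (horner p) = b.
  by rewrite /ip /b /mean; congr (fine (muint V _)); apply/funext => x; rewrite expr2.
have := mean_adjoint_sqr_le sV r0 HV HK (dH p^`()) (pH _).1 (pH _) (pH _)
  (polygrowthM polygrowth_V' (pH p^`())).
have -> : mean V (fun x => (V' x * p^`().[x] - p^`()^`().[x]) ^+ 2) =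
    ip V (fun x => V' x * p^`().[x] - p^`()^`().[x]) (fun x => V' x * p^`().[x] - p^`()^`().[x]).
  by rewrite /ip /mean; congr (fine (muint V _)); apply/funext => x; rewrite expr2.
move: CS; rewrite bE; set A := ip V _ _ => CS H.
have HA : A <= n.+1%:R * K * a.
  by apply: le_trans H _; rewrite -natr1 mulrDl mul1r mulrDl lerD2r; exact: IH.
have [aE|an] := eqVneq a 0.
  by rewrite aE mulr_ge0 // mulr_ge0 // ltW.
have ap : 0 < a by rewrite lt_neqAle eq_sym an.
rewrite -(ler_pM2r ap) -expr2; apply: le_trans CS _.
apply: le_trans (ler_wpM2r b0 HA) _.
by rewrite -!mulrA [b * a]mulrC.
Qed.

(** Convergence comes from an explicit rate: each error carries a factor [1 / (k + 1)] against a
    fixed majorant of polynomial growth. *)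
Lemma muint_sqr_cvg0 (g : nat -> R -> R) (h : R -> R) :
  (forall k, continuous (g k)) -> polygrowth h ->
  (forall k x, `|g k x| <= (k.+1%:R)^-1 * h x) ->
  (fun k => muint V (fun x => g k x ^+ 2)) @ \oo --> 0%E.
Proof.
move=> cg ph Hg.
have pg k : polygrowth (g k) := polygrowth_le (cg k) (polygrowthZ _ ph) (Hg k).
have ph2 := polygrowthX 2 ph; have pg2 k := polygrowthX 2 (pg k).
have -> : (fun k => muint V (fun x => g k x ^+ 2)) =
    (EFin \o (fun k => mean V (fun x => g k x ^+ 2))).
  by apply/funext => k; rewrite /= muintE //; exact: pInt.
apply: cvg_EFin; first exact: nearW.
apply: (squeeze_cvgr (f := fun=> 0) (h := fun k => mean V (fun x => h x ^+ 2) * harmonic k)).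
- near=> k; rewrite mean_ge0 /=; last by move=> x; exact: sqr_ge0.
  rewrite mulrC /harmonic -meanZ; last exact: pInt.
  apply: le_mean; [exact: pInt|exact/pInt/polygrowthZ|move=> x].
  have k1 : (k.+1%:R)^-1 <= 1 :> R by rewrite invf_le1 ?ltr0n // ler1n.
  have k0 : 0 <= (k.+1%:R)^-1 :> R by rewrite invr_ge0.
  apply: (@le_trans _ _ (((k.+1%:R)^-1 * h x) ^+ 2)).
    rewrite -(real_normK (num_real (g k x))) ler_sqr ?nnegrE //.
    exact: le_trans (normr_ge0 _) (Hg k x).
  rewrite exprMn ler_wpM2r ?sqr_ge0 // expr2 ler_piMl //.
- exact: cvg_cst.
- rewrite -[X in _ --> X](mulr0 (mean V (fun x => h x ^+ 2))).
  by apply: cvgM; [exact: cvg_cst|exact: cvg_harmonic].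
Unshelve. all: by end_near. Qed.

Lemma LopE (f df ddf : R -> R) : has_derivative f df -> has_derivative df ddf ->
  Lop V f = (fun x => ddf x - V' x * df x).
Proof.
move=> D1 D2; apply/funext => x.
by rewrite /Lop /derive1n /= (has_derivative_derive1 D1) (has_derivative_derive1 D2).
Qed.

Lemma Lop_continuous (f : R -> R) : smooth f -> continuous (Lop V f).
Proof.
move=> sf; rewrite (_ : Lop V f = fun x => derive1n 2 f x + -1 * (V' x * derive1 f x)).
  apply: continuous_add; first exact: V''_continuous.
  apply: continuous_mul; first by move=> x; exact: cvg_cst.
  by apply: continuous_mul; exact: V'_continuous.
by apply/funext => x; rewrite /Lop mulN1r.
Qed.

(** Polynomials lie in the domain of the closure, through the cutoffs [chi(x / (k + 1)) p(x)]. Every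
    error term gains a factor [1 / (k + 1)], either from a derivative of the cutoff or from
    [chi - 1]. *)
Lemma graphL_horner (p : {poly R}) :
  graphL V (horner p) (fun x => p^`()^`().[x] - V' x * p^`().[x]).
Proof.
have pLp : polygrowth (fun x => p^`()^`().[x] - V' x * p^`().[x]).
  rewrite (_ : (fun x => _) = fun x => -1 * (V' x * p^`().[x] - p^`()^`().[x])).
    exact: polygrowthZ.
  by apply/funext => x; ring.
split; first exact: pL2; split; first exact: pL2.
have [chi [schi chi0 suppchi]] := bump_exists R.
pose chi1 := derive1 chi; pose chi2 := derive1 chi1.
have schi1 : smooth chi1 by exact: smooth_derive1.
have Dchi : has_derivative chi chi1 by exact: smooth_has_derivative1.
have Dchi1 : has_derivative chi1 chi2 by exact: smooth_has_derivative1.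
have Dchi2 : has_derivative chi2 (derive1 chi2).
  exact/smooth_has_derivative1/smooth_derive1.
have c0 := has_derivative_continuous Dchi; have c1 := has_derivative_continuous Dchi1.
have c2 := has_derivative_continuous Dchi2.
have s1 := derive1_compact_support suppchi; have s2 := derive1_compact_support s1.
have [B1 HB1] := compact_support_bounded c1 s1.
have [B2 HB2] := compact_support_bounded c2 s2.
have B10 : 0 <= B1 := le_trans (normr_ge0 _) (HB1 0).
have B20 : 0 <= B2 := le_trans (normr_ge0 _) (HB2 0).
(* Since [chi 0 = 1] and [chi1] is bounded, [chi - 1] is small near 0; the growing factor [|y|] is
   harmless in a majorant of polynomial growth. *)
have chiB y : `|chi y - 1| <= B1 * `|y|.
  have lip a b : a <= b -> `|chi b - chi a| <= B1 * `|b - a|.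
    move=> ab; have [c _ ->] := has_derivative_mean_value Dchi ab.
    by rewrite normrM ler_wpM2r.
  rewrite -chi0; have [y0|y0] := leP 0 y; first by have := lip _ _ y0; rewrite subr0.
  by have := lip _ _ (ltW y0); rewrite sub0r normrN distrC.
pose e k : R := (k.+1%:R)^-1.
have e0 k : 0 <= e k by rewrite invr_ge0.
have e1 k : e k <= 1 by rewrite invf_le1 ?ltr0n // ler1n.
pose phi k x := chi (e k * x + 0) * p.[x].
have Dp := dH p; have Dp1 := dH p^`().
have D1 k := has_derivativeM (has_derivative_affine (e k) 0 Dchi) Dp.
have D2 k := has_derivativeD
  (has_derivativeM (has_derivativeZ (e k) (has_derivative_affine (e k) 0 Dchi1)) Dp)
  (has_derivativeM (has_derivative_affine (e k) 0 Dchi) Dp1).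
have chiBk k x : `|chi (e k * x + 0) - 1| <= e k * (B1 * `|x|).
  apply: le_trans (chiB _) _; rewrite addr0 normrM (ger0_norm (e0 k)).
  by rewrite mulrCA.
have sphi k : smooth (phi k) by apply: smoothM; [exact: smooth_affine|exact: smooth_horner].
exists phi; split; [|split].
- move=> k; split; first exact: sphi.
  exists k.+1%:R => x Hx; rewrite /phi suppchi ?mul0r // addr0 normrM (ger0_norm (e0 k)).
  by rewrite /e mulrC ltr_pdivlMr ?ltr0n // mul1r.
- apply: (@muint_sqr_cvg0 _ (fun x => B1 * `|x| * `|p.[x]|)).
  + move=> k; have cphi := has_derivative_continuous (D1 k).
    by move=> x; apply: cvgB; [exact: cphi|exact: (pH p).1].
  + by apply: polygrowthM; [apply: polygrowthZ|]; apply: polygrowth_norm => //;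
      exact: polygrowth_id.
  + move=> k x; rewrite /phi -[X in _ - X]mul1r -mulrBl normrM mulrA.
    by rewrite ler_wpM2r.
- pose h x := B1 * `|x| * `|p^`()^`().[x] - V' x * p^`().[x]| +
    (B2 * `|p.[x]| + (2 * B1) * `|p^`().[x]| + B1 * (`|V' x| * `|p.[x]|)).
  apply: (@muint_sqr_cvg0 _ h).
  + by move=> k x; apply: cvgB; [exact: Lop_continuous (sphi k) x|exact: pLp.1].
  + apply: polygrowthD.
      apply: polygrowthM; last exact: polygrowth_norm.
      exact/polygrowthZ/polygrowth_norm/polygrowth_id.
    apply: polygrowthD; last first.
      by apply/polygrowthZ/polygrowthM; apply: polygrowth_norm => //; exact: polygrowth_V'.
    by apply: polygrowthD; apply/polygrowthZ/polygrowth_norm.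
  + move=> k x; rewrite (LopE (D1 k) (D2 k)) -/(e k).
    set y := e k * x + 0.
    set q := p^`()^`().[x] - V' x * p^`().[x].
    (* The error splits into [(chi - 1) L p] and the commutator of L with the cutoff, from which one
       factor [e k] is extracted; the second one, in front of [chi2], is then bounded by 1. *)
    have -> : e k * (e k * chi2 y) * p.[x] + e k * chi1 y * p^`().[x] +
        (e k * chi1 y * p^`().[x] + chi y * p^`()^`().[x]) -
        V' x * (e k * chi1 y * p.[x] + chi y * p^`().[x]) - q =
      (chi y - 1) * q + e k * (e k * (chi2 y * p.[x]) + 2 * (chi1 y * p^`().[x])
        - chi1 y * (V' x * p.[x])) by rewrite /q; ring.
    apply: le_trans (ler_normD _ _) _; rewrite /h [leRHS]mulrDr; apply: lerD.
      by rewrite normrM mulrA ler_wpM2r // chiBk.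
    rewrite normrM (ger0_norm (e0 k)) ler_wpM2l //.
    apply: le_trans (ler_normB _ _) _; apply: lerD; last first.
      by rewrite !normrM ler_wpM2r // mulr_ge0.
    apply: le_trans (ler_normD _ _) _; apply: lerD.
      rewrite !normrM (ger0_norm (e0 k)).
      apply: (@le_trans _ _ (1 * (B2 * `|p.[x]|))); last by rewrite mul1r.
      by apply: ler_pM => //; exact: ler_wpM2r.
    by rewrite !normrM (ger0_norm (ler0n _ _)) -mulrA ler_wpM2l // ler_wpM2r.
Unshelve. all: by end_near. Qed.

Lemma ip_suml (n : nat) (c : 'I_n -> R) (f : 'I_n -> R -> R) (g : R -> R) :
  (forall i, L2 V (f i)) -> L2 V g ->
  ip V (fun x => \sum_(i < n) c i * f i x) g = \sum_(i < n) c i * ip V (f i) g.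
Proof.
move=> Lf Lg.
suff H (s : seq 'I_n) : L2 V (fun x => \sum_(i <- s) c i * f i x) /\
    ip V (fun x => \sum_(i <- s) c i * f i x) g = \sum_(i <- s) c i * ip V (f i) g.
  by case: (H (index_enum 'I_n)).
elim: s => [|i s [L IH]].
  have E : (fun x => \sum_(i <- [::]) c i * f i x) = (fun=> 0).
    by apply/funext => x; rewrite big_nil.
  rewrite big_nil E; split; first exact/pL2/polygrowth_cst.
  rewrite /ip /muint (_ : (\int[_]_x _ = 0)%E) //.
  by apply: integral0_eq => x _; rewrite !mul0r.
have E : (fun x => \sum_(j <- i :: s) c j * f j x) =
    (fun x => c i * f i x + \sum_(j <- s) c j * f j x).
  by apply/funext => x; rewrite big_cons.
have Lc : L2 V (fun x => c i * f i x) := L2Z cV _ (Lf i).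
rewrite E; split; first exact: L2D.
by rewrite (ipDl cV Lc L Lg) (ipZl cV _ (Lf i) Lg) big_cons IH.
Qed.

(** Orthogonality imposes [n] linear conditions on [n + 1] coefficients: the matrix of the
    [<x^i, g_j>] has rank at most [n], so a nonzero row of its left kernel supplies the
    coefficients. *)
Lemma orthogonal_polynomial (n : nat) (gs : 'I_n -> R -> R) : (forall i, L2 V (gs i)) ->
  exists p : {poly R}, [/\ p != 0, (size p <= n.+1)%N & forall i, ip V (horner p) (gs i) = 0].
Proof.
move=> Lgs; pose A : 'M[R]_(n.+1, n) := \matrix_(i, j) ip V (fun x => x ^+ i) (gs j).
have Ker : kermx A != 0.
  rewrite kermx_eq0 /row_free; apply/eqP => E.
  by have := rank_leq_col A; rewrite E ltnn.
pose c := nz_row (kermx A).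
have c0 : c != 0 by rewrite nz_row_eq0.
have cA : c *m A = 0 by apply/sub_kermxP; exact: nz_row_sub.
pose p := \poly_(i < n.+1) c 0 (inord i).
exists p; split; last first.
- move=> j; have -> : horner p = (fun x => \sum_(i < n.+1) c 0 i * x ^+ i).
    apply/funext => x; rewrite horner_poly; apply: eq_bigr => i _.
    by rewrite inord_val.
  rewrite ip_suml //; last by move=> i; exact/pL2/polygrowthX/polygrowth_id.
  have E := congr1 (fun M : 'rV_n => M 0 j) cA; rewrite !mxE in E; rewrite -[RHS]E.
  by apply: eq_bigr => i _; rewrite !mxE.
- exact: size_poly.
- apply: contraNneq c0 => pz; apply/eqP/rowP => i; rewrite mxE.
  have := congr1 (fun q : {poly R} => q`_i) pz.
  by rewrite coef_poly ltn_ord inord_val coef0.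
Qed.

(** A nonzero polynomial is nonzero somewhere, as otherwise [0, ..., size p - 1] would be [size p]
    distinct roots; continuity then gives positivity. *)
Lemma ip_horner_gt0 (p : {poly R}) : p != 0 -> 0 < ip V (horner p) (horner p).
Proof.
move=> p0; have [x0 Hx0] : exists x0, p.[x0] != 0.
  apply: contrapT => H.
  have H1 x : p.[x] = 0 by apply/eqP/negPn/negP => px; apply: H; exists x.
  have := @max_poly_roots _ p [seq i%:R | i <- iota 0 (size p)] p0.
  rewrite size_map size_iota ltnn => F; suff : false by [].
  apply: F; first by apply/allP => x _; rewrite rootE H1.
  by rewrite map_inj_uniq ?iota_uniq // => i j /eqP; rewrite eqr_nat => /eqP.
apply: (@mean_gt0 R V cV _ x0).
- by apply: pInt; exact: polygrowthM.
- by have [c _] := polygrowthM (pH p) (pH p).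
- exact: Zc_gt0 sV r0 HV.
- by move=> x; rewrite -expr2 sqr_ge0.
- by rewrite -expr2 exprn_even_gt0.
Qed.

(** For each choice of constraints the infimum is at most the Rayleigh quotient of an orthogonal
    polynomial, and the supremum inherits this uniform bound. *)
Lemma lambda_le (n : nat) : (lambda V n <= (n%:R * K)%:E)%E.
Proof.
apply: ge_ereal_sup => _ [gs [Lgs ->]].
have [p [p0 sp op]] := orthogonal_polynomial Lgs.
have pp := ip_horner_gt0 p0.
apply: le_trans (_ : ((- ip V (horner p) (fun x => p^`()^`().[x] - V' x * p^`().[x])) /
   ip V (horner p) (horner p))%:E <= _)%E.
  apply: ereal_inf_lbound; exists (horner p), (fun x => p^`()^`().[x] - V' x * p^`().[x]).
  split; first exact: graphL_horner.
  by split; [apply/eqP; rewrite gt_eqF|].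
rewrite lee_fin ler_pdivrMr //.
have -> : (fun x => p^`()^`().[x] - V' x * p^`().[x]) =
    (fun x => -1 * (V' x * p^`().[x] - p^`()^`().[x])) by apply/funext => x; ring.
rewrite ipC (ipZl cV _ (pL2 (pA p)) (pL2 (pH p))) mulN1r opprK -mean_adjoint_horner.
apply: le_trans (polynomial_energy_le sp) _.
by rewrite le_eqVlt; apply/orP; left; apply/eqP; congr (_ * _).
Qed.

End UpperBound.

(** * The two bounds on the max-min values *)

(** The supremum is tested with the monomials [1, ..., x^(n-1)] as constraints; every admissible [f]
    then satisfies the spectral gap inequality. *)
Lemma lambda_ge (R : realType) (V : R -> R) (r : R) (n : nat) :
  smooth V -> 0 < r -> (forall x, r <= derive1n 2 V x) -> ((n%:R * r)%:E <= lambda V n)%E.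
Proof.
move=> sV r0 HV; apply: le_ereal_sup_tmp.
eexists; first by exists (fun (i : 'I_n) x => x ^+ i); split; [|reflexivity];
  move=> i; exact/(polygrowth_L2 sV r0 HV)/polygrowthX/polygrowth_id.
apply: le_ereal_inf_tmp => _ [f [Lf [gf [fn [fo ->]]]]].
have fp : 0 < ip V f f by rewrite lt_neqAle eq_sym ip_ge0 andbT; apply/eqP.
rewrite lee_fin ler_pdivlMr //.
apply: (graphL_spectral_gap sV r0 HV gf) => i Hi; exact: (fo (Ordinal Hi)).
Qed.

Theorem mainTheorem7 (R : realType) (V : R -> R) (n : nat) :
  smooth V ->
  (0 < ereal_inf (range (fun x => (derive1n 2 V x)%:E)))%E ->
  (1 <= n)%N ->
  ((n%:R)%:E * ereal_inf (range (fun x => (derive1n 2 V x)%:E)) <= lambda V n)%E /\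
  (lambda V n <= (n%:R)%:E * ereal_sup (range (fun x => (derive1n 2 V x)%:E)))%E.
Proof.
move=> sV; set I := ereal_inf _; set S := ereal_sup _ => I0 n1.
have HI x : (I <= (derive1n 2 V x)%:E)%E by apply: ereal_inf_lbound; exists x.
have HS x : ((derive1n 2 V x)%:E <= S)%E by apply: ereal_sup_ubound; exists x.
(* Positivity excludes [-oo] and the finite value [V'' 0] excludes [+oo], so the infimum is a real
   [r > 0]. *)
case: I I0 HI => [r||] //; last by move=> _ /(_ 0).
rewrite lte_fin => r0 HI.
have HV x : r <= derive1n 2 V x by rewrite -lee_fin.
split; first by rewrite -EFinM; exact: lambda_ge.
case: S HS => [K||] HS.
- rewrite -EFinM; apply: (lambda_le sV r0 HV) => x; rewrite -lee_fin; exact: HS.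
(* With an infinite supremum the product is [+oo] because [n >= 1]; for [n = 0] it would be 0. *)
- by rewrite gt0_muley ?leey // lte_fin ltr0n.
- by have := HS 0.
Qed.
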